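(* Let $n\ge 2$ and let $0<d\le n$, $0\le\alpha<n$, $0\le\gamma\le\alpha$. Let $p,q$ satisfy $d/n<p\le q<n/\gamma$ and $p<d/\alpha$ (where $q<n/\gamma$ means $q<\infty$ if $\gamma=0$, and $p<d/\alpha$ means $p<\infty$ if $\alpha=0$), and put $$\delta=\frac{q}{p}\bigl(d-(\alpha-\gamma)p\bigr).$$ Then there exists a finite constant $C>0$, independent of $f$ and $w$, such that for every weight $w$ on $\mathbb{R}^n$ and every locally integrable function $f$ on $\mathbb{R}^n$, $$\|\mathfrak{M}_{\alpha}f\|_{L^{q,p}(H^{\delta}_{w})}\le C\,\|f\|_{L^{p}(H^{d}_{(\mathfrak{M}_{\gamma q}w)^{p/q}})}.$$
   Context: A weight on $\mathbb{R}^n$ is a nonnegative locally integrable function. $\mathcal{D}$ is the family of all dyadic cubes $Q=2^{-k}(j+[0,1)^n)$, $k\in\mathbb{Z}$, $j\in\mathbb{Z}^n$; $l(Q)$ is the side length of $Q$, $|Q|$ its Lebesgue measure, $\mathbf{1}_E$ the characteristic function of $E$, and $⨍_Q f\,dx:=\frac{1}{|Q|}\int_Q f\,dx$ is the integral average, written below as $\frac{1}{|Q|}\int_Q f\,dx$. Dyadic fractional maximal operator of order $\beta\ge 0$: for locally integrable $f$, $$\mathfrak{M}_{\beta}f(x):=\sup_{Q\in\mathcal{D}}\mathbf{1}_Q(x)\,\Bigl(\frac{1}{|Q|}\int_Q|f|\,dy\Bigr)\,l(Q)^{\beta}\in[0,\infty].$$ Weighted Hausdorff content: for an exponent $s>0$,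 a nonnegative measurable function $v$ on $\mathbb{R}^n$ (possibly taking the value $\infty$) and $E\subset\mathbb{R}^n$, $$H^{s}_{v}(E):=\inf\sum_{j=1}^{\infty}\Bigl(\frac{1}{|Q_j|}\int_{Q_j}v\,dx\Bigr)\,l(Q_j)^{s},$$ the infimum being over all coverings of $E$ by countable families of dyadic cubes $Q_j$. Choquet-Lorentz quasinorm: for $0<r,s<\infty$, an exponent $\sigma>0$ and a nonnegative measurable function $v$ on $\mathbb{R}^n$ (possibly taking the value $\infty$), $$\|g\|_{L^{r,s}(H^{\sigma}_{v})}:=\Bigl(\int_0^{\infty}\bigl(t^{r}H^{\sigma}_{v}(\{x\in\mathbb{R}^n:|g(x)|>t\})\bigr)^{s/r}\,\frac{dt}{t}\Bigr)^{1/s},$$ and $L^{r}(H^{\sigma}_v):=L^{r,r}(H^{\sigma}_v)$. *)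

(* Defs.v *)
From HB Require Import structures.
From mathcomp Require Import all_boot all_order all_algebra.
From mathcomp Require Import all_classical all_reals all_analysis.

Set Implicit Arguments.
Unset Strict Implicit.
Unset Printing Implicit Defensive.

Import Order.TTheory GRing.Theory Num.Theory.
Import numFieldNormedType.Exports.

Local Open Scope classical_set_scope.
Local Open Scope ring_scope.

Section borel_structure.
Context {R : realType}.

Definition coordinate_sets (n : nat) : set (set 'rV[R]_n) :=
  [set A | exists i : 'I_n, exists2 B : set R,
     measurable B & A = [set x : 'rV[R]_n | B (x ord0 i)]].

Definition borel_rV (n : nat) := g_sigma_algebraType (@coordinate_sets n).

Definition cons_rV (n : nat) (z : R * borel_rV n) : borel_rV n.+1 :=
  row_mx (const_mx z.1 : 'rV_1) z.2 : 'rV_(1 + n).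

Definition uncons_rV (n : nat) (x : borel_rV n.+1) : R * borel_rV n :=
  let y : 'rV_(1 + n) := x in (y ord0 ord0, rsubmx y).

Lemma cons_rV0 n (z : R * borel_rV n) :
  (cons_rV z : 'rV_n.+1) ord0 ord0 = z.1.
Proof.
rewrite (_ : ord0 = lshift n (ord0 : 'I_1)) ?[LHS]row_mxEl ?mxE//.
exact: val_inj.
Qed.

Lemma cons_rVS n (z : R * borel_rV n) (j : 'I_n) :
  (cons_rV z : 'rV_n.+1) ord0 (lift ord0 j) = (z.2 : 'rV_n) ord0 j.
Proof.
rewrite (_ : lift ord0 j = rshift 1 j) ?[LHS]row_mxEr//.
exact: val_inj.
Qed.

Lemma cons_rVK n : cancel (@cons_rV n) (@uncons_rV n).
Proof.
by case=> a y; rewrite /uncons_rV cons_rV0 /= /cons_rV row_mxKr.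
Qed.

Lemma measurable_coord n (i : 'I_n) :
  measurable_fun [set: borel_rV n] (fun x => (x : 'rV_n) ord0 i).
Proof.
move=> _ B mB; rewrite setTI; apply: sub_sigma_algebra.
by exists i; exists B.
Qed.

Lemma measurable_cons_rV n : measurable_fun setT (@cons_rV n).
Proof.
apply: (@measurability _ _ _ (borel_rV n.+1) _ _ (@coordinate_sets n.+1)) => //.
move=> _ [_ [i [B mB ->]] <-]; rewrite setTI.
case: (unliftP ord0 i) => [j|] ->.
- rewrite (_ : _ @^-1` _ = (fun z => (z.2 : 'rV_n) ord0 j) @^-1` B); last first.
    by apply/seteqP; split => z /=; rewrite cons_rVS.
  rewrite -[X in measurable X]setTI.
  apply: (measurableT_comp (measurable_coord j) measurable_snd) => //.
- rewrite (_ : _ @^-1` _ = fst @^-1` B); last first.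
    by apply/seteqP; split => z /=; rewrite cons_rV0.
  by rewrite -[X in measurable X]setTI; exact: measurable_fst.
Qed.

Lemma measurable_uncons_rV n : measurable_fun setT (@uncons_rV n).
Proof.
apply/measurable_fun_pairP; split; first exact: (measurable_coord ord0).
apply: (@measurability _ _ _ (borel_rV n) _ _ (@coordinate_sets n)) => //.
move=> _ [_ [i [B mB ->]] <-]; rewrite setTI.
apply: sub_sigma_algebra; exists (lift ord0 i); exists B => //.
apply/seteqP; split => x /=; rewrite mxE.
all: by rewrite (_ : rshift 1 i = lift ord0 i)//; exact: val_inj.
Qed.

End borel_structure.
Arguments coordinate_sets : clear implicits.
Arguments borel_rV : clear implicits.

Section lebesgue_rV.
Context {R : realType}.
Local Open Scope ereal_scope.

Section succ.
Variables (n : nat) (m : {sigma_finite_measure set (borel_rV R n) -> \bar R}).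

Definition borel_lebesgue_succ : set (borel_rV R n.+1) -> \bar R :=
  pushforward (@lebesgue_measure R \x m) (@cons_rV R n).

Let pushforward_succ : {measure set (borel_rV R n.+1) -> \bar R} :=
  measure_function_pushforward__canonical__measure_function_Measure
    (@lebesgue_measure R \x m) (@measurable_cons_rV R n).

Let succ0 : borel_lebesgue_succ set0 = 0.
Proof. by rewrite /borel_lebesgue_succ /pushforward preimage_set0 measure0. Qed.

Let succ_ge0 A : 0 <= borel_lebesgue_succ A.
Proof. exact: (measure_ge0 (pushforward_succ)). Qed.

Let succ_sigma_additive : semi_sigma_additive borel_lebesgue_succ.
Proof.
exact (@measure_semi_sigma_additive _ _ _ pushforward_succ).
Qed.

HB.instance Definition _ := isMeasure.Build _ _ _ borel_lebesgue_succ
  succ0 succ_ge0 succ_sigma_additive.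

Let succ_sigma_finite : sigma_finite setT borel_lebesgue_succ.
Proof.
have /sigma_finiteP[F [TF ndF Foo]] := sigma_finiteT (@lebesgue_measure R).
have /sigma_finiteP[G [TG ndG Goo]] := sigma_finiteT m.
exists (fun k => @uncons_rV R n @^-1` (F k `*` G k)).
  rewrite -preimage_bigcup (_ : \bigcup_k _ = setT) ?preimage_setT//.
  apply/seteqP; split => // -[x y] _.
  have [k _ Fkx] : (\bigcup_k F k) x by rewrite -TF.
  have [l _ Gly] : (\bigcup_k G k) y by rewrite -TG.
  exists (maxn k l) => //; split.
  - by move: x Fkx; exact/subsetPset/ndF/leq_maxl.
  - by move: y Gly; exact/subsetPset/ndG/leq_maxr.
move=> k; have [mFk Fk] := Foo k; have [mGk Gk] := Goo k; split.
  rewrite -[X in measurable X]setTI; apply: measurable_uncons_rV => //.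
  exact: measurableX.
rewrite /= /borel_lebesgue_succ /pushforward -comp_preimage.
rewrite (_ : _ \o _ = id); last by rewrite funeqE => z; exact: cons_rVK.
by rewrite [ltLHS]product_measure1E// lte_mul_pinfty// ge0_fin_numE.
Qed.

HB.instance Definition _ := Measure_isSigmaFinite.Build _ _ _
  borel_lebesgue_succ succ_sigma_finite.

End succ.

Fixpoint borel_lebesgue (n : nat) :
    {sigma_finite_measure set (borel_rV R n) -> \bar R} :=
  match n with
  | 0 => \d_ (0%R : borel_rV R 0)
  | n'.+1 => borel_lebesgue_succ (borel_lebesgue n')
  end.

(* Lebesgue measure on R^n: the n-fold product of the one-dimensional Lebesgue
   measure, completed so that its domain is the sigma-algebra of all
   Lebesgue-measurable sets. *)
Definition lebesgue_rV (n : nat) :=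
  @completed_measure_extension _ _ _ (borel_lebesgue n).

HB.instance Definition _ n := Measure.on (@lebesgue_rV n).

Lemma lebesgue_rVE n (A : set (borel_rV R n)) : measurable A ->
  lebesgue_rV (A : set (caratheodory_type (borel_lebesgue n)^*%mu)) =
  borel_lebesgue n A.
Proof.
by move=> mA; rewrite /lebesgue_rV /completed_measure_extension measurable_mu_extE.
Qed.

Definition box (n : nat) (a b : 'rV[R]_n) : set 'rV[R]_n :=
  [set x | forall i, (a ord0 i <= x ord0 i < b ord0 i)%R].

Lemma measurable_box n (a b : 'rV[R]_n) :
  measurable (box a b : set (borel_rV R n)).
Proof.
rewrite (_ : box a b = \bigcap_(i in [set: 'I_n])
    ((fun x : borel_rV R n => (x : 'rV_n) ord0 i) @^-1`
       `[a ord0 i, b ord0 i[%classic)); last first.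
  apply/seteqP; split => x /=.
    by move=> xab i _ /=; rewrite in_itv/=; exact: xab.
  by move=> xab i; have := xab i I; rewrite /= in_itv.
apply: fin_bigcap_measurable => // i _.
by rewrite -[X in measurable X]setTI; exact: measurable_coord.
Qed.

Lemma borel_lebesgue_box n (a b : 'rV[R]_n) :
  (forall i, (a ord0 i <= b ord0 i)%R) ->
  borel_lebesgue n (box a b) = (\prod_i (b ord0 i - a ord0 i))%:E.
Proof.
elim: n => [|n IHn] in a b * => ab.
  rewrite big_ord0 /= diracE (_ : _ \in _ = true)//.
  by apply/mem_set => -[].
pose tl (x : 'rV[R]_n.+1) : 'rV[R]_n := \row_i x ord0 (lift ord0 i).
rewrite /= /borel_lebesgue_succ /pushforward.
rewrite (_ : _ @^-1` _ =
    `[a ord0 ord0, b ord0 ord0[%classic `*` box (tl a) (tl b)); last first.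
  apply/seteqP; split => -[x y] /=.
    move=> xab; split => /=.
      by rewrite in_itv/=; have := xab ord0; rewrite cons_rV0.
    by move=> i; have := xab (lift ord0 i); rewrite cons_rVS !mxE.
  rewrite in_itv/= => -[x0 yab] i; case: (unliftP ord0 i) => [j|] ->.
    by rewrite cons_rVS; have := yab j; rewrite !mxE.
  by rewrite cons_rV0.
rewrite [LHS]product_measure1E//; last exact: measurable_box.
rewrite IHn; last by move=> i; rewrite !mxE.
rewrite big_ord_recl EFinM; congr (_ * _); last first.
  by congr EFin; apply: eq_bigr => i _; rewrite !mxE.
rewrite [LHS]lebesgue_measure_itv/= lte_fin.
have := ab ord0; rewrite le_eqVlt => /predU1P[->|->]//.
by rewrite ltxx subrr.
Qed.

Lemma lebesgue_rV_box n (a b : 'rV[R]_n) :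
  (forall i, (a ord0 i <= b ord0 i)%R) ->
  lebesgue_rV (box a b : set (caratheodory_type (borel_lebesgue n)^*%mu)) =
  (\prod_i (b ord0 i - a ord0 i))%:E.
Proof.
move=> ab; rewrite lebesgue_rVE; last exact: measurable_box.
exact: borel_lebesgue_box.
Qed.

End lebesgue_rV.
Arguments lebesgue_rV : clear implicits.

Section locally_integrable_rV.
Context {R : realType} {n : nat}.

Definition locally_integrable_rV (f : 'rV[R]_n -> R) :=
  measurable_fun [set: caratheodory_type (borel_lebesgue n)^*%mu] f /\
  forall K : set 'rV[R]_n, compact K ->
    (\int[lebesgue_rV R n]_(x in K) `|f x|%:E < +oo)%E.

Definition weight (w : 'rV[R]_n -> R) :=
  (forall x, 0 <= w x) /\ locally_integrable_rV w.

End locally_integrable_rV.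

(* The pair (k, j) stands for the dyadic cube 2^{-k}(j + [0,1)^n). *)
Definition dyadic (n : nat) := (int * 'rV[int]_n)%type.

Section dyadic_cubes.
Context {R : realType} {n : nat}.
Implicit Types (Q : dyadic n) (v : 'rV[R]_n -> \bar R).
Local Open Scope ereal_scope.

Definition side Q : R := (2 ^ (- Q.1))%R.

Definition cube Q : set 'rV[R]_n :=
  let j : 'rV[R]_n := map_mx intr Q.2 in
  box (side Q *: j)%R (side Q *: (j + const_mx 1))%R.

Definition avg Q v : \bar R :=
  (fine (lebesgue_rV R n (cube Q)))^-1%:E * \int[lebesgue_rV R n]_(x in cube Q) v x.

Definition dyadic_maximal (beta : R) (f : 'rV[R]_n -> R) (x : 'rV[R]_n) :
    \bar R :=
  ereal_sup (range (fun Q : dyadic n =>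
    (\1_(cube Q) x)%:E * avg Q (fun y => `|f y|%:E) * (side Q `^ beta)%:E)).

(* [J] selects the indices in use, so that finite coverings, and the empty
   covering of the empty set, are countable coverings too. *)
Definition hausdorff_content (s : R) v (E : set 'rV[R]_n) : \bar R :=
  ereal_inf [set y | exists (J : pred nat) (Q : nat -> dyadic n),
    E `<=` \bigcup_(j in [set j | J j]) cube (Q j) /\
    y = \sum_(j <oo | J j) (avg (Q j) v * (side (Q j) `^ s)%:E)].

Definition choquet_lorentz (r s sigma : R) v (g : 'rV[R]_n -> \bar R) : \bar R :=
  (\int[lebesgue_measure]_(t in `]0%R, +oo[)
     (((t `^ r)%:E * hausdorff_content sigma v [set x | t%:E < `|g x|])
        `^ (s / r) * (t^-1)%:E)) `^ s^-1.

Definition choquet (r sigma : R) v (g : 'rV[R]_n -> \bar R) : \bar R :=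
  choquet_lorentz r r sigma v g.

End dyadic_cubes.

(* Main.v *)
From HB Require Import structures.
Require Import Defs.
From mathcomp Require Import all_boot all_order all_algebra finmap.
From mathcomp Require Import all_classical all_reals all_analysis.
From mathcomp Require Import measurable_realfun ring lra.

(* Cover each set {|f| > 2^k} almost optimally by dyadic cubes Q, so that the sum
   S of 2^(kp) l(Q)^d avg_Q v is comparable to the p-th power of the right-hand
   side.  If P witnesses M_alpha f > 2^m on P, put t = 2^m l(P)^(-alpha), so that
   avg_P |f| > t.  Either P lies in a covering cube of level 2^k > t/8, which can
   then replace P, or t |P| <= 8 sum 2^k |Q| over the covering cubes Q inside P of
   level > t/8.  Raising the latter to the power kappa = d/n <= 1 yields
   (t/8)^kappa l(P)^d <= sum 2^(k kappa) l(Q)^d, in which l(Q) enters exactly as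
   in the content.  Since v >= (avg_P w)^(p/q) l(P)^(gamma p) on P and p/q <= 1,
   the cost of P on the left is at most a multiple of the sum of
   (t/2^k)^(p - kappa) 2^(kp) l(Q)^d avg_Q v with t/2^k < 8.
   Using at every m only the maximal such cubes P, each Q is counted at most once
   for each m, and t at least doubles when m increases by one, so that the sum
   over m is geometric because p > kappa.  A cube P without a maximal cube above
   it is harmless: alpha < n forces the cost of ever larger cubes to be controlled
   by tails of the convergent sum S, hence to tend to 0. *)

Set Implicit Arguments.
Unset Strict Implicit.
Unset Printing Implicit Defensive.

Import Order.TTheory GRing.Theory Num.Theory.
Import numFieldNormedType.Exports.

Local Open Scope classical_set_scope.
Local Open Scope ring_scope.

(** * Sums over countable sets *)

(** For [0 <= z <= s = x + y] one has [z / s <= (z / s)^r] because [r <= 1]; adding the cases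
    [z = x] and [z = y] gives the claim. *)
Lemma powR_subadditive (R : realType) (r x y : R) :
  0 < r <= 1 -> 0 <= x -> 0 <= y -> (x + y) `^ r <= x `^ r + y `^ r.
Proof.
move=> /andP[r0 r1] x0 y0.
have [xy0|] := leP (x + y) 0.
  have -> : x + y = 0 by lra.
  by rewrite powR0 ?gt_eqF// addr_ge0 ?powR_ge0.
set s := x + y => s0.
have le_frac z : 0 <= z -> z <= s -> z / s * s `^ r <= z `^ r.
  move=> z0 zs; have [->|zN0] := eqVneq z 0; first by rewrite !mul0r powR_ge0.
  have zgt0 : 0 < z by rewrite lt_neqAle eq_sym zN0.
  rewrite -[leRHS](_ : (z / s) `^ r * s `^ r = _); last first.
    rewrite -powRM ?divr_ge0 ?(ltW s0)//.
    by rewrite divfK// gt_eqF.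
  rewrite ler_wpM2r ?powR_ge0// ger1_powR// divr_gt0//=.
  by rewrite ler_pdivrMr// mul1r.
apply: le_trans (lerD (le_frac x x0 _) (le_frac y y0 _)); rewrite /s; try lra.
by rewrite -mulrDl -mulrDl divff ?mul1r ?gt_eqF.
Qed.

Lemma geometric_gap (R : realType) (th : R) : 0 < th -> 0 < 1 - 2 `^ (- th) :> R.
Proof.
move=> th0; rewrite subr_gt0 powRN invf_lt1 ?powR_gt0//.
have := @gt0_ltr_powR R th th0 1 2; rewrite powR1 !nnegrE.
by apply; rewrite ?ltr1n.
Qed.

(** The sum over [j >= 0] of the series with terms [(U / 2^j)^th]. *)
Definition geometric_const (R : realType) (U th : R) : R :=
  (1 - 2 `^ (- th))^-1 * U `^ th.

Lemma geometric_const_ge0 (R : realType) (U th : R) :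
  0 < th -> 0 <= geometric_const U th.
Proof.
by move=> th0; rewrite mulr_ge0 ?powR_ge0// invr_ge0 ltW// geometric_gap.
Qed.

Section extended_reals.
Context {R : realType}.
Local Open Scope ereal_scope.

Lemma le_poweR (r : R) (x y : \bar R) :
  (0 <= r)%R -> 0 <= x -> x <= y -> x `^ r <= y `^ r.
Proof.
move=> r0 x0 xy; apply: gt0_ler_poweR => //; rewrite in_itv/= ?leey ?andbT//.
exact: le_trans xy.
Qed.

Lemma poweR_subadditive (r : R) (x y : \bar R) :
  (0 < r <= 1)%R -> 0 <= x -> 0 <= y -> (x + y) `^ r <= x `^ r + y `^ r.
Proof.
move=> r01; have r0 : r != 0%R by case/andP: r01 => ? _; rewrite gt_eqF.
case: x y => [x| |] [y| |]// x0 y0; last 3 first.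
- by rewrite addeC /= (negbTE r0).
- by rewrite /= (negbTE r0).
- by rewrite /= (negbTE r0).
by rewrite -EFinD !poweR_EFin -EFinD lee_fin powR_subadditive.
Qed.

Lemma poweR_sum_le (T : Type) (r : R) (s : seq T) (a : T -> \bar R) :
  (0 < r <= 1)%R -> (forall t, 0 <= a t) ->
  (\sum_(t <- s) a t) `^ r <= \sum_(t <- s) a t `^ r.
Proof.
move=> r01 a0; elim: s => [|t s IH].
  by rewrite !big_nil poweR0r//; case/andP: r01 => ? _; rewrite gt_eqF.
rewrite !big_cons; apply: le_trans (leeD (lexx _) IH).
by apply: poweR_subadditive => //; exact: sume_ge0.
Qed.

End extended_reals.

Section esum_lemmas.
Context {R : realType}.
Local Open Scope ereal_scope.

Lemma le_esum_subset (T : choiceType) (I J : set T) (a : T -> \bar R) :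
  I `<=` J -> \esum_(i in I) a i <= \esum_(i in J) a i.
Proof.
move=> IJ; apply: ge_ereal_sup => _ [X [finX XI] <-].
by apply: esum_ge; exists X => //; split => //; exact: subset_trans IJ.
Qed.

Lemma esum_le_finite (T : choiceType) (I : set T) (a : T -> \bar R) M :
  (forall s : seq T, uniq s -> (forall t, t \in s -> I t) ->
     \sum_(t <- s) a t <= M) ->
  \esum_(i in I) a i <= M.
Proof.
move=> h; apply: ge_ereal_sup => _ [X [finX XI] <-].
rewrite fsbig_finite//; apply: h; first exact: fset_uniq.
by move=> t; rewrite in_fset_set// inE => /XI.
Qed.

Lemma le_esum_seq (T : choiceType) (I : set T) (a : T -> \bar R) (s : seq T) :
  uniq s -> (forall t, t \in s -> I t) ->
  \sum_(t <- s) a t <= \esum_(i in I) a i.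
Proof.
move=> us sI; apply: esum_ge; exists [set` s].
  by split; [exact: finite_seq|exact: sI].
by rewrite -fsbig_seq.
Qed.

(** Both inner index sets may depend on the outer index; the equivalence says that the two iterated
    sums run over the same pairs. *)
Lemma esum_swap (T1 T2 : choiceType) (I : set T1) (J : T1 -> set T2)
    (J' : set T2) (I' : T2 -> set T1) (a : T1 -> T2 -> \bar R) :
  (forall i j, 0 <= a i j) ->
  (forall i j, I i /\ J i j <-> J' j /\ I' j i) ->
  \esum_(i in I) \esum_(j in J i) a i j =
  \esum_(j in J') \esum_(i in I' j) a i j.
Proof.
move=> a0 IJ; rewrite esum_esum// esum_esum//.
rewrite (@reindex_esum R _ _ (J' `*`` I') (I `*`` J)
  (fun x => (x.2, x.1)))//; split => //=.
- by move=> [j i] /= /IJ.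
- by move=> [j i] [j' i'] _ _ /= [-> ->].
- by move=> [i j] /= /IJ h; exists (j, i).
Qed.

Lemma esumZl (T : choiceType) (I : set T) (a : T -> \bar R) (c : \bar R) :
  0 <= c -> (forall i, 0 <= a i) ->
  \esum_(i in I) (c * a i) = c * \esum_(i in I) a i.
Proof.
have le_c (c' : \bar R) b : 0 <= c' -> (forall i, 0 <= b i) ->
    \esum_(i in I) (c' * b i) <= c' * \esum_(i in I) b i.
  move=> c0 b0; apply: esum_le_finite => s us sI.
  by rewrite -ge0_sume_distrr// lee_wpmul2l// le_esum_seq.
move=> c0 a0; apply/eqP; rewrite eq_le le_c//=.
case: c c0 => [c|_|//].
  have [-> _|cN0] := eqVneq c 0%R.
    by rewrite mul0e esum_ge0// => i _; rewrite mul0e.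
  rewrite lee_fin => c_ge0; have {cN0 c_ge0} c0 : (0 < c)%R by rewrite lt0r cN0.
  (* The reverse inequality is [le_c] for the constant [c^-1] and the terms [c * a i]. *)
  rewrite -lee_pdivlMl//; apply: le_trans (le_c _ _ _ _) => //; last 2 first.
  - by rewrite lee_fin invr_ge0 ltW.
  - by move=> i; rewrite mule_ge0// lee_fin ltW.
  apply: le_esum => i _; rewrite muleA -EFinM mulVf ?gt_eqF// mul1e.
  exact: lexx.
(* For [c = +oo] both sides vanish if all terms do; otherwise a single positive term makes both
   infinite. *)
have [h|] := pselect (forall i, I i -> a i = 0).
  by rewrite [X in _ * X]esum1// mule0 esum_ge0// => i _; rewrite mule_ge0.
move=> /existsNP[i /not_implyP[Ii ai]].
have ai0 : 0 < a i by rewrite lt0e a0 andbT; apply/eqP.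
apply: (@le_trans _ _ (+oo * a i)); first by rewrite (gt0_mulye ai0) leey.
have := @le_esum_seq _ I (fun i => +oo * a i) [:: i].
rewrite big_seq1; apply => //.
by move=> t; rewrite inE => /eqP ->.
Qed.

Lemma le_esumU (T : choiceType) (I J : set T) (a : T -> \bar R) :
  (forall i, 0 <= a i) ->
  \esum_(i in I `|` J) a i <= \esum_(i in I) a i + \esum_(i in J) a i.
Proof.
move=> a0; rewrite (@esumID _ _ I)//; apply: leeD.
  by apply: le_esum_subset => i [].
by apply: le_esum_subset => i [[]].
Qed.

(** Each image point is counted on the right once for every preimage, hence at least once. *)
Lemma le_esum_image (T1 T2 : choiceType) (I : set T1) (h : T1 -> T2)
    (a : T2 -> \bar R) : (forall i, 0 <= a i) ->
  \esum_(j in h @` I) a j <= \esum_(i in I) a (h i).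
Proof.
move=> a0.
apply: (@le_trans _ _ (\esum_(j in h @` I) \esum_(i in I `&` [set i | h i = j]) a j)).
  apply: le_esum => _ [i Ii <-].
  have := @le_esum_seq _ (I `&` [set i' | h i' = h i]) (fun=> a (h i)) [:: i].
  rewrite big_seq1; apply => //.
  by move=> t; rewrite inE => /eqP ->.
rewrite (@esum_swap _ _ _ _ I (fun i => [set h i]) (fun j _ => a j))//.
  by apply: le_esum => i Ii; rewrite esum_set1.
move=> j i; split => [[_ [Ii <-]]//|[Ii ->]].
by split; [exists i|].
Qed.

Lemma esum_poweR_le (T : choiceType) (I : set T) (a : T -> \bar R) (r : R) :
  (0 < r <= 1)%R -> (forall i, 0 <= a i) ->
  (\esum_(i in I) a i) `^ r <= \esum_(i in I) a i `^ r.
Proof.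
move=> r01 a0; have r0 : (0 < r)%R by case/andP: r01.
have e0 : 0 <= \esum_(i in I) a i `^ r by apply: esum_ge0 => i _; exact: poweR_ge0.
(* Moving the exponent to the right as [1 / r] leaves a plain sum on the left, for which finite
   partial sums suffice. *)
rewrite -[leRHS]poweRe1// -(@mulVf _ r) ?gt_eqF// poweRrM.
apply: le_poweR; [exact: ltW|exact: esum_ge0|].
apply: esum_le_finite => s us sI.
rewrite -[leLHS]poweRe1 ?sume_ge0// -(@mulfV _ r) ?gt_eqF// poweRrM.
apply: le_poweR; [by rewrite invr_ge0 ltW|exact: poweR_ge0|].
by apply: le_trans (poweR_sum_le _ _ _) _ => //; exact: le_esum_seq.
Qed.

Lemma esum_tail (T : choiceType) (I : set T) (a : T -> \bar R) (e : R) :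
  (forall i, 0 <= a i) -> \esum_(i in I) a i < +oo -> (0 < e)%R ->
  exists2 X : set T, finite_set X & \esum_(i in I `\` X) a i <= e%:E.
Proof.
move=> a0 afin e0.
have Sfin : \esum_(i in I) a i \is a fin_num.
  by rewrite ge0_fin_numE// esum_ge0.
have [_ [X [finX XI] <-] hX] := ub_ereal_sup_adherent e0 Sfin.
exists X => //; move: hX.
have eX : \esum_(i in X) a i = \sum_(i \in X) a i by rewrite esum_fset.
have Xfin : \esum_(i in X) a i \is a fin_num.
  rewrite ge0_fin_numE ?esum_ge0//; apply: le_lt_trans afin.
  exact: le_esum_subset.
rewrite -/(esum _ _) [X in X - _ < _](esumID X)// setIidr// -eX.
rewrite lteBlDr// lteD2lE// => /ltW.
by [].
Qed.

Lemma esum_epsilon (T : countType) (e : R) : (0 < e)%R ->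
  exists2 g : T -> R, (forall t, 0 < g t)%R & \esum_(t in setT) (g t)%:E <= e%:E.
Proof.
move=> e0; exists (fun t => e / (2 ^ (choice.pickle t).+1)%:R)%R.
  by move=> t; rewrite divr_gt0// ltr0n expn_gt0.
rewrite -(@esum_image _ _ _ setT choice.pickle (fun n => (e / (2 ^ n.+1)%:R)%:E)).
  apply: le_trans (le_esum_subset _ (@subsetT _ _)) _.
  rewrite -nneseries_esumT.
    exact: (epsilon_trick0 xpredT (ltW e0)).
  by move=> n; rewrite lee_fin divr_ge0// ltW.
by move=> x y _ _; exact: (pcan_inj choice.pickleK).
Qed.

(** Passes from a sum over a countable set to a series over [nat], the form taken by integrals of
    series and by the coverings in [hausdorff_content]. One enumeration serves all summands. *)
Lemma esum_countE (T : countType) (t0 : T) (A : set T) :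
  exists (P : pred nat) (h : nat -> T),
    (forall t, A t <-> exists2 n, P n & h n = t) /\
    (forall a : T -> \bar R, (forall t, 0 <= a t) ->
       \esum_(t in A) a t = \sum_(n <oo | P n) a (h n)).
Proof.
pose P n := if pickle_inv n is Some t then t \in A else false.
pose h n : T := odflt t0 (pickle_inv n).
have hA t : A t <-> exists2 n, P n & h n = t.
  split => [At|[n]].
    exists (choice.pickle t); rewrite /P /h pickleK_inv//.
    by rewrite inE.
  by rewrite /P /h; case: pickle_inv => //= t'; rewrite inE => ? <-.
exists P, h; split => // a a0.
have -> : A = h @` [set n | P n].
  apply/seteqP; split => t; first by move=> /hA[n Pn <-]; exists n.
  by move=> [n Pn <-]; apply/hA; exists n.
rewrite esum_pred_image// => m n.
rewrite !inE /= /P /h.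
have := @pickle_invK T m; have := @pickle_invK T n.
by case: (pickle_inv m) => //= x; case: (pickle_inv n) => //= y <- <- _ _ ->.
Qed.

(** Listed by decreasing index, the positive terms at least halve at each step, so a geometric
    series starting at [U^th] dominates. The value 0 may occur anywhere; it marks indices at which
    no cube occurs. *)
Lemma esum_geometric (u : int -> R) (U th : R) : (0 < th)%R ->
  (forall m, 0 <= u m <= U)%R ->
  (forall m m', m < m' -> 0 < u m' -> u m <= u m' / 2)%R ->
  \esum_(m in setT) (u m `^ th)%:E <= (geometric_const U th)%:E.
Proof.
move=> th0 u0 uS.
have K0 := geometric_gap th0.
rewrite /geometric_const; set K := (1 - _)^-1%R.
apply: esum_le_finite => s us _; rewrite sumEFin lee_fin.
have [L sL ->] : exists2 L, sorted >%O L &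
    (\sum_(m <- s) u m `^ th = \sum_(m <- L) u m `^ th)%R.
  exists (rev (sort <=%O s)).
    by rewrite rev_sorted lt_sorted_uniq_le sort_uniq us sort_le_sorted.
  by apply: perm_big; rewrite perm_sym perm_rev perm_sort.
have uU m : m \in L -> (u m <= U)%R by move=> _; case/andP: (u0 m).
have U0 : (0 <= U)%R by case/andP: (u0 0%R) => /le_trans; exact.
have {}u0 m : (0 <= u m)%R by case/andP: (u0 m).
elim: L U U0 uU sL => {us s} [|m s IH] U U0 uU.
  by move=> _; rewrite big_nil mulr_ge0 ?powR_ge0// invr_ge0 ltW.
move=> /= ms; rewrite big_cons.
have ss : sorted >%O s by exact: path_sorted ms.
have uUm : (u m <= U)%R by apply: uU; rewrite inE eqxx.
have := u0 m; rewrite le_eqVlt => /predU1P[um0|um0].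
  rewrite -um0 powR0 ?gt_eqF// add0r; apply: IH => //.
  by move=> m' m's; apply: uU; rewrite inE m's orbT.
apply: (@le_trans _ _ (K * u m `^ th)%R); last first.
  rewrite ler_wpM2l ?invr_ge0 ?(ltW K0)//.
  by apply: ge0_ler_powR; rewrite ?nnegrE// ltW.
(* The rest of the list is bounded by [u m / 2], which replaces [U] in the induction hypothesis. *)
have /IH : (0 <= u m / 2)%R by rewrite divr_ge0// ltW.
have um' m' : m' \in s -> (u m' <= u m / 2)%R.
  move=> m's; apply: uS => //.
  have gt_trans : transitive (>%O : rel int).
    by move=> y x z /= xy yz; exact: lt_trans yz xy.
  by move: ms; rewrite (path_sortedE gt_trans) => /andP[/allP/(_ _ m's)].
move=> /(_ um' ss) h.
apply: le_trans (lerD (lexx _) h) _.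
rewrite powRM ?(ltW um0)// ?invr_ge0// -powR_inv1// -powRrM mulN1r.
have KE : ((1 - 2 `^ (- th)) * K = 1)%R by rewrite /K mulfV// gt_eqF.
rewrite -[X in (X + _)%R]mul1r -[X in (X * _ + _)%R]KE.
rewrite le_eqVlt; apply/orP; left; apply/eqP.
ring.
Qed.

End esum_lemmas.

(** * Integrals and dyadic sums *)

Section integrals.
Local Open Scope ereal_scope.
Context d (T : measurableType d) (R : realType).
Variable mu : {measure set T -> \bar R}.

(* Unlike [ge0_le_integral], no measurability is required: the integral of a
   nonnegative function is a supremum over the simple functions below it. *)
Lemma le_integral_nonneg (D : set T) (f g : T -> \bar R) :
  (forall x, D x -> 0 <= f x) -> (forall x, D x -> f x <= g x) ->
  \int[mu]_(x in D) f x <= \int[mu]_(x in D) g x.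
Proof.
move=> f0 fg; rewrite !(integral_mkcond D).
have h0 x : 0 <= (f \_ D) x by exact: erestrict_ge0.
have hg x : (f \_ D) x <= (g \_ D) x by exact: lee_restrict.
have g0 x : 0 <= (g \_ D) x by exact: le_trans (hg x).
rewrite !ge0_integralTE//; apply: ereal_sup_le => _ [h hf <-].
by exists h => // x; exact: le_trans (hg x).
Qed.

Lemma measurable_esum (I : countType) (i0 : I) (A : set I) (D : set T)
    (f : I -> T -> \bar R) :
  (forall i, measurable_fun D (f i)) -> (forall i x, 0 <= f i x) ->
  measurable_fun D (fun x => \esum_(i in A) f i x).
Proof.
move=> mf f0; have [P [h [_ hE]]] := @esum_countE R I i0 A.
rewrite (_ : (fun _ => _) = (fun x => \sum_(n <oo | P n) f (h n) x)).
  exact: ge0_emeasurable_sum.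
by apply/funext => x; rewrite hE.
Qed.

Lemma integral_esum (I : countType) (i0 : I) (A : set I) (D : set T)
    (f : I -> T -> \bar R) :
  measurable D -> (forall i, measurable_fun D (f i)) ->
  (forall i x, 0 <= f i x) ->
  \int[mu]_(x in D) (\esum_(i in A) f i x) =
  \esum_(i in A) \int[mu]_(x in D) f i x.
Proof.
move=> mD mf f0; have [P [h [_ hE]]] := @esum_countE R I i0 A.
rewrite hE; last by move=> i; exact: integral_ge0.
rewrite (eq_integral (fun x => \sum_(n <oo | P n) f (h n) x)); last first.
  by move=> x _; rewrite hE.
rewrite eseries_mkcond.
rewrite (eq_integral (fun x => \sum_(n <oo) (if P n then f (h n) x else 0))).
  rewrite integral_nneseries//.
  - apply: eq_eseriesr => n _; case: (P n) => //.
    by rewrite integral0.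
  - by move=> n; case: (P n) => //; exact: measurable_cst.
  - by move=> n x _; case: (P n).
by move=> x _; rewrite eseries_mkcond.
Qed.

(** Evaluates the integral of the pointwise majorant of [|f|] built in [avg_level_cover]. *)
Lemma integral_affine_esum_indic (I : countType) (i0 : I) (A : set I)
    (D : set T) (c : I -> R) (B : I -> set T) (r s : R) :
  measurable D -> (forall i, measurable (B i)) -> (forall i, 0 <= c i)%R ->
  (0 <= r)%R -> (0 <= s)%R ->
  \int[mu]_(x in D)
    (r%:E + s%:E * \esum_(i in A) ((c i)%:E * (\1_(B i) x)%:E)) =
  r%:E * mu D + s%:E * \esum_(i in A) ((c i)%:E * mu (B i `&` D)).
Proof.
move=> mD mB c0 r0 s0.
have m1 i : measurable_fun D (fun x => (\1_(B i) x)%:E : \bar R).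
  by apply/measurable_EFinP; exact: measurable_indic.
have mc i : measurable_fun D (fun x => (c i)%:E * (\1_(B i) x)%:E : \bar R).
  exact: measurable_funeM.
have c1 i x : 0 <= (c i)%:E * (\1_(B i) x)%:E :> \bar R.
  by rewrite mule_ge0// lee_fin.
have G0 x : 0 <= \esum_(i in A) ((c i)%:E * (\1_(B i) x)%:E) :> \bar R.
  by apply: esum_ge0.
have mG := measurable_esum i0 A mc c1.
rewrite ge0_integralD//; last 2 first.
- by move=> x _; rewrite mule_ge0// lee_fin.
- exact: measurable_funeM.
congr (_ + _); first by rewrite integral_cst.
rewrite ge0_integralZl ?lee_fin//; congr (_ * _).
rewrite (integral_esum i0)//; apply: eq_esum => i _.
by rewrite ge0_integralZl ?lee_fin// integral_indic.
Qed.

End integrals.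

(** * Integrals in t compared with sums over powers of two *)

Section dyadic_intervals.
Context {R : realType}.

Lemma dyadic_floor (t : R) : 0 < t -> exists m : int, 2 ^ m <= t < 2 ^ (m + 1).
Proof.
move=> t0; pose m := Num.floor (ln t / ln 2).
have l2 : 0 < ln 2 :> R by rewrite ln_gt0// ltr1n.
exists m; have /andP[m1 m2] := floor_itv (ln t / ln 2).
have E (z : int) : (2 : R) ^ z = expR (z%:~R * ln 2).
  by rewrite -powR_intmul// /powR pnatr_eq0.
rewrite !E -[X in _ <= X < _](lnK t0).
rewrite ler_expR ltr_expR; apply/andP; split.
  by rewrite -ler_pdivlMr.
by rewrite -ltr_pdivrMr.
Qed.

Lemma ltr_exp2z (m m' : int) : ((2 : R) ^ m < 2 ^ m') = (m < m').
Proof. by rewrite ltr_eXz2l ?ltr1n. Qed.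

Lemma ler_exp2z (m m' : int) : ((2 : R) ^ m <= 2 ^ m') = (m <= m').
Proof. by rewrite ler_eXz2l ?ltr1n. Qed.

Lemma exp2z_gt0 (m : int) : 0 < (2 : R) ^ m.
Proof. by rewrite exprz_gt0. Qed.

Lemma exp2zD (m m' : int) : (2 : R) ^ (m + m') = 2 ^ m * 2 ^ m'.
Proof. by rewrite expfzDr ?pnatr_eq0. Qed.

Lemma dyadic_floor_uniq (t : R) (m m' : int) :
  2 ^ m <= t < 2 ^ (m + 1) -> 2 ^ m' <= t < 2 ^ (m' + 1) -> m = m'.
Proof.
move=> /andP[a b] /andP[a' b'].
have := le_lt_trans a b'; have := le_lt_trans a' b.
by rewrite !ltr_exp2z !ltzD1 => h1 h2; apply/eqP; rewrite eq_le h1 h2.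
Qed.

Local Open Scope ereal_scope.

Let I (m : int) : set R := `[(2 ^ m)%R, (2 ^ (m + 1))%R[%classic.

Let mI m : measurable (I m). Proof. exact: measurable_itv. Qed.

(** A step function with value [c m] on [I m]; these intervals partition the positive half-line and
    [I m] has length [2^m]. *)
Let G (c : int -> \bar R) (t : R) :=
  \esum_(m in [set: int]) (c m * (\1_(I m) t)%:E).

Let GE c m t : (forall m, 0 <= c m) -> (2 ^ m <= t < 2 ^ (m + 1))%R ->
  G c t = c m.
Proof.
move=> c0 tm; rewrite /G (esumID [set m])//; last first.
  by move=> i _; rewrite mule_ge0// lee_fin.
rewrite setTI esum_set1; last by rewrite mule_ge0// lee_fin.
rewrite [X in _ + X]esum1 ?adde0.
  have It : I m t by rewrite /I/= in_itv/=.
  by rewrite indicE mem_set// mule1.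
move=> m' [_ /= m'm]; rewrite indicE memNset ?mule0//.
rewrite /I /= in_itv/= => tm'; apply: m'm; exact: dyadic_floor_uniq tm.
Qed.

Let int_G c : (forall m, 0 <= c m) ->
  \int[lebesgue_measure]_(t in `]0%R, +oo[) G c t =
  \esum_(m in [set: int]) (c m * (2 ^ m)%:E).
Proof.
move=> c0; have mE m (D : set R) :
    measurable_fun D (fun t : R => (\1_(I m) t)%:E : \bar R).
  by apply/measurable_EFinP; exact: measurable_indic.
rewrite (@integral_esum _ _ _ _ _ (0%R : int))//; last 2 first.
- move=> m; apply: (measurable_funeM (c m) (mE m _)).
- by move=> m t; rewrite mule_ge0// lee_fin.
apply: eq_esum => m _; rewrite ge0_integralZl//; last exact: mE.
rewrite integral_indic//; last exact: mI.
rewrite setIidl; last first.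
  move=> t /=; rewrite !in_itv/= andbT => /andP[tm _].
  exact: lt_le_trans (exp2z_gt0 m) tm.
rewrite [X in _ * X](_ : _ = (2 ^ m)%:E)//.
rewrite [LHS]lebesgue_measure_itv/= lte_fin ltr_exp2z ltzD1 lexx.
by rewrite -EFinD exp2zD; congr EFin; rewrite expr1z; lra.
Qed.

Lemma le_integral_dyadic (F : R -> \bar R) (c : int -> \bar R) :
  (forall t, (0 < t)%R -> 0 <= F t) -> (forall m, 0 <= c m) ->
  (forall m t, (2 ^ m <= t < 2 ^ (m + 1))%R -> F t <= c m) ->
  \int[lebesgue_measure]_(t in `]0%R, +oo[) F t <=
  \esum_(m in [set: int]) (c m * (2 ^ m)%:E).
Proof.
move=> F0 c0 Fc; rewrite -int_G//; apply: le_integral_nonneg => t /=;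
  rewrite in_itv/= andbT; first exact: F0.
move=> /dyadic_floor[m tm].
by rewrite (GE c0 tm) Fc.
Qed.

Lemma ge_integral_dyadic (F : R -> \bar R) (c : int -> \bar R) :
  (forall m, 0 <= c m) ->
  (forall m t, (2 ^ m <= t < 2 ^ (m + 1))%R -> c m <= F t) ->
  \esum_(m in [set: int]) (c m * (2 ^ m)%:E) <=
  \int[lebesgue_measure]_(t in `]0%R, +oo[) F t.
Proof.
move=> c0 Fc; rewrite -int_G//; apply: le_integral_nonneg => t /=.
  by move=> _; apply: esum_ge0 => m _; rewrite mule_ge0// lee_fin.
rewrite in_itv/= andbT => /dyadic_floor[m tm].
by rewrite (GE c0 tm) Fc.
Qed.

(** On [[2^m, 2^(m+1))] one has [H t <= H (2^m)] and [t^q <= 2^((m+1)q)], while [1/t <= 2^(-m)]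
    cancels the length of the interval; the exponent [p/q] turns the excess [2^q] into [2^p]. *)
Lemma le_integral_level (H : R -> \bar R) (p q : R) : (0 < p)%R -> (0 < q)%R ->
  (forall t, 0 <= H t) -> {homo H : s t / (s <= t)%R >-> t <= s} ->
  \int[lebesgue_measure]_(t in `]0%R, +oo[)
     (((t `^ q)%:E * H t) `^ (p / q) * (t^-1)%:E) <=
  (2 `^ p)%:E * \esum_(m in [set: int]) (((2 ^ m) `^ p)%:E * H (2 ^ m)%R `^ (p / q)).
Proof.
move=> p0 q0 H0 Hmono.
have tH0 t s : 0 <= (t `^ q)%:E * H s by rewrite mule_ge0// lee_fin powR_ge0.
apply: (@le_trans _ _ (\esum_(m in [set: int])
    (((2 ^ (m + 1)) `^ q)%:E * H (2 ^ m)%R) `^ (p / q) * ((2 ^ m)^-1)%:E *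
    (2 ^ m)%:E)).
  apply: le_integral_dyadic => [t t0|m|m t /andP[mt tm]].
  - by rewrite mule_ge0 ?poweR_ge0// lee_fin invr_ge0 ltW.
  - by rewrite mule_ge0 ?poweR_ge0// lee_fin invr_ge0 ltW// exp2z_gt0.
  have m0 := exp2z_gt0 m; have t0 : (0 < t)%R by exact: lt_le_trans mt.
  apply: lee_pmul; rewrite ?poweR_ge0//.
  - by rewrite lee_fin invr_ge0 ltW.
  - apply: le_poweR => //; first by rewrite divr_ge0// ltW.
    apply: lee_pmul => //; first by rewrite lee_fin powR_ge0.
      rewrite lee_fin; apply: ge0_ler_powR; rewrite ?nnegrE; try exact: ltW.
      exact/ltW/exp2z_gt0.
    exact: Hmono.
  - by rewrite lee_fin lef_pV2.
rewrite -esumZl ?lee_fin ?powR_ge0//; last first.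
  by move=> m; rewrite mule_ge0 ?poweR_ge0// lee_fin powR_ge0.
apply: le_esum => m _; have m0 := exp2z_gt0 m.
rewrite -muleA -EFinM mulVf ?gt_eqF// mule1.
rewrite poweRM//; last by rewrite lee_fin powR_ge0.
rewrite muleA -EFinM poweR_EFin -powRrM mulrCA divff ?gt_eqF// mulr1.
by rewrite exp2zD expr1z powRM ?(ltW m0)// mulrC.
Qed.

(** On [[2^m, 2^(m+1))] monotonicity gives [H t >= H (2^(m+1))], so the sum is shifted by one index,
    at the price of [2^p] from [t^p] and 2 from [1/t]. The exponent [p / p] is the one produced by
    [choquet]. *)
Lemma ge_integral_level (H : R -> \bar R) (p : R) : (0 < p)%R ->
  (forall t, 0 <= H t) -> {homo H : s t / (s <= t)%R >-> t <= s} ->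
  \esum_(m in [set: int]) (((2 ^ m) `^ p)%:E * H (2 ^ m)%R) <=
  (2 * 2 `^ p)%:E * \int[lebesgue_measure]_(t in `]0%R, +oo[)
     (((t `^ p)%:E * H t) `^ (p / p) * (t^-1)%:E).
Proof.
move=> p0 H0 Hmono.
pose c m := ((2 ^ m) `^ p)%:E * H (2 ^ (m + 1))%R * ((2 ^ (m + 1))^-1)%:E.
have pow0 m : (0 <= 2 ^ m :> R)%R by rewrite ltW// exp2z_gt0.
have c0 m : 0 <= c m.
  by rewrite !mule_ge0// lee_fin ?powR_ge0// invr_ge0.
have := @ge_integral_dyadic (fun t => ((t `^ p)%:E * H t) `^ (p / p) * (t^-1)%:E) c c0.
have -> : \esum_(m in [set: int]) (((2 ^ m) `^ p)%:E * H (2 ^ m)%R) =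
    \esum_(m in [set: int]) (((2 ^ (m + 1)) `^ p)%:E * H (2 ^ (m + 1))%R).
  apply: (@reindex_esum R _ _ setT setT (fun m => m + 1)%R
    (fun m => ((2 ^ m) `^ p)%:E * H (2 ^ m)%R)).
  split => // [m m' _ _ /addIr//|m _]; exists (m - 1)%R => //.
  by rewrite subrK.
move=> h; rewrite (@eq_esum _ _ _ _ (fun m => (2 * 2 `^ p)%:E * (c m * (2 ^ m)%:E))).
  rewrite esumZl ?lee_fin ?mulr_ge0 ?powR_ge0//; last first.
    by move=> m; rewrite mule_ge0// lee_fin.
  rewrite lee_wpmul2l ?lee_fin ?mulr_ge0 ?powR_ge0//; apply: h.
  move=> m t /andP[mt tm]; rewrite divff ?gt_eqF// poweRe1; last first.
    by rewrite mule_ge0// lee_fin powR_ge0.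
  have t0 : (0 < t)%R by apply: lt_le_trans mt; exact: exp2z_gt0.
  apply: lee_pmul.
  - by rewrite mule_ge0// lee_fin powR_ge0.
  - by rewrite lee_fin invr_ge0.
  - apply: lee_pmul => //; first by rewrite lee_fin powR_ge0.
      by rewrite lee_fin; apply: ge0_ler_powR; rewrite ?nnegrE ?(ltW p0) ?(ltW t0).
    by apply: Hmono; exact: ltW.
  - by rewrite lee_fin lef_pV2 ?posrE ?exp2z_gt0// ltW.
move=> m _; rewrite /c -[X in _ = _ * X]muleA -EFinM.
rewrite [X in _ = _ * X]muleAC -EFinM muleA -EFinM.
congr (_%:E * _); rewrite exp2zD expr1z powRM//.
by field; rewrite gt_eqF// exp2z_gt0.
Qed.

End dyadic_intervals.

(** * Dyadic cubes *)

Section dyadic_cubes.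
Context {R : realType} {n : nat}.
Implicit Types (P Q : dyadic n) (x : 'rV[R]_n).
Local Notation side := (@side R n).
Local Notation cube := (@cube R n).

Lemma side_gt0 Q : 0 < side Q. Proof. exact: exp2z_gt0. Qed.
#[local] Hint Resolve side_gt0 : core.

Lemma side_ge0 Q : 0 <= side Q. Proof. exact: ltW. Qed.
#[local] Hint Resolve side_ge0 : core.

Lemma le_side P Q : (P.1 <= Q.1)%R -> side Q <= side P.
Proof. by move=> PQ; rewrite /side ler_exp2z lerN2. Qed.

Lemma cubeE Q x : cube Q x <->
  forall i, (Q.2 ord0 i)%:~R <= x ord0 i / side Q < (Q.2 ord0 i)%:~R + 1.
Proof.
rewrite /cube /box /=; split => h i; have := h i; rewrite !mxE.
  by rewrite ler_pdivlMr// ltr_pdivrMr// ![side Q * _]mulrC.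
by rewrite ler_pdivlMr// ltr_pdivrMr// ![side Q * _]mulrC.
Qed.

Lemma cube_floor Q x i : cube Q x -> Num.floor (x ord0 i / side Q) = Q.2 ord0 i.
Proof.
by move=> /cubeE/(_ i) h; apply: floor_def; rewrite intrD.
Qed.

Lemma cube_neq0 Q : cube Q !=set0.
Proof.
exists (\row_i (side Q * (Q.2 ord0 i)%:~R)); apply/cubeE => i.
by rewrite mxE mulrAC divff ?gt_eqF// mul1r lexx ltrDl ltr01.
Qed.

Lemma cube_uniq P Q x : P.1 = Q.1 -> cube P x -> cube Q x -> P = Q.
Proof.
case: P Q => [k j] [k' j'] /= <- Px Qx; congr pair.
apply/rowP => i.
by rewrite -[RHS](cube_floor i Qx) -[LHS](cube_floor i Px).
Qed.

(** In units of the side of [Q], each edge of [P] runs from [j 2^N] to [(j+1) 2^N], both integers. A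
    unit interval with integer endpoints that meets this edge lies inside it. *)
Lemma cube_nested P Q x :
  (P.1 <= Q.1)%R -> cube P x -> cube Q x -> cube Q `<=` cube P.
Proof.
move=> PQ Px Qx y Qy.
have [N sPQ] : exists N : nat, side P = side Q * 2 ^+ N.
  exists `|Q.1 - P.1|%N; rewrite /side exprnP gez0_abs ?subr_ge0//.
  by rewrite -exp2zD; congr (_ ^ _); ring.
apply/cubeE => i.
have /cubeE/(_ i) := Px; have /cubeE/(_ i) := Qx; have /cubeE/(_ i) := Qy.
set s := side Q in sPQ *.
set j := P.2 ord0 i; set j' := Q.2 ord0 i.
have s0 : 0 < s by exact: side_gt0.
have E z : (z : R) / side P = z / s / 2 ^+ N.
  by rewrite sPQ invfM mulrA.
have N0 : 0 < (2 : R) ^+ N by rewrite exprn_gt0.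
rewrite !E !(ler_pdivlMr _ _ N0) !(ltr_pdivrMr _ _ N0).
move: (x ord0 i / s) (y ord0 i / s) => X Y /andP[Y1 Y2] /andP[X1 X2] /andP[X3 X4].
have E1 z : z%:~R + 1 = (z + 1)%:~R :> R by rewrite intrD.
have e : (j%:~R * 2 ^+ N = (j * 2 ^+ N)%:~R :> R) by rewrite intrM rmorphXn.
have e' : ((j%:~R + 1) * 2 ^+ N = ((j + 1) * 2 ^+ N)%:~R :> R).
  by rewrite intrM intrD rmorphXn.
move: X3 X4; rewrite e e' => X3 X4.
have h1 : (j * 2 ^+ N <= j')%R.
  by have := le_lt_trans X3 X2; rewrite E1 ltr_int ltzD1.
have h2 : (j' + 1 <= (j + 1) * 2 ^+ N)%R.
  by have := le_lt_trans X1 X4; rewrite ltr_int lezD1.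
apply/andP; split.
  by apply: le_trans Y1; rewrite ler_int.
by apply: lt_le_trans Y2 _; rewrite E1 ler_int.
Qed.

Lemma measurable_cube Q :
  measurable (cube Q : set (caratheodory_type (borel_lebesgue n)^*%mu)).
Proof. apply: sub_caratheodory; apply: sub_sigma_algebra; exact: measurable_box. Qed.

Lemma lebesgue_cube Q : lebesgue_rV R n (cube Q) = (side Q ^+ n)%:E.
Proof.
rewrite lebesgue_rV_box; last first.
  by move=> i; rewrite !mxE ler_wpM2l// lerDl.
rewrite (eq_bigr (fun=> side Q)) ?prodr_const ?card_ord// => i _.
by rewrite !mxE; ring.
Qed.

Local Open Scope ereal_scope.

Lemma avg_ge0 Q (v : 'rV[R]_n -> \bar R) : (forall x, 0 <= v x) -> 0 <= avg Q v.
Proof.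
move=> v0; rewrite /avg lebesgue_cube mule_ge0//=.
  by rewrite lee_fin invr_ge0 exprn_ge0.
exact: integral_ge0.
Qed.

Lemma le_avg Q (v : 'rV[R]_n -> \bar R) b :
  0 <= b -> (forall x, cube Q x -> b <= v x) -> b <= avg Q v.
Proof.
move=> b0 bv; rewrite /avg lebesgue_cube /=.
have s0 : (0 < side Q ^+ n)%R by rewrite exprn_gt0.
apply: (@le_trans _ _ ((side Q ^+ n)^-1%:E * (b * (side Q ^+ n)%:E))).
  by rewrite muleCA -EFinM mulVf ?gt_eqF// mule1.
rewrite lee_wpmul2l ?lee_fin ?invr_ge0 ?(ltW s0)//.
rewrite -lebesgue_cube -integral_cst; last exact: measurable_cube.
by apply: le_integral_nonneg.
Qed.

End dyadic_cubes.

(** * Level sets of averages *)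

Section level_cover.
Context {R : realType} {n : nat}.
Local Open Scope ereal_scope.
Local Notation side := (@side R n).
Local Notation cube := (@cube R n).

(** Where [|f| > lam/2], it is at most [4 * 2^(k i)] for a covering cube with [2^(k i) > lam/8].
    Integrating over [P] and absorbing the part [lam/2] bounds [(lam/8) |P|] by the sum of
    [2^(k i) |Q i|] over such cubes inside [P]. The subadditive power [kappa] then turns volumes
    into [d]-th powers of sides. *)
Lemma avg_level_cover (T : countType) (i0 : T) (A : set T) (k : T -> int)
    (Q : T -> dyadic n) (f : 'rV[R]_n -> R) (P : dyadic n) (lam kappa d : R) :
  (0 < lam)%R -> (0 < kappa <= 1)%R -> (d = n%:R * kappa)%R ->
  (forall m x, (2 ^ m < `|f x|)%R -> exists i, [/\ A i, k i = m & cube (Q i) x]) ->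
  (forall i, A i -> (lam < 8 * 2 ^ k i)%R -> ((Q i).1 <= P.1)%R ->
     ~ cube P `<=` cube (Q i)) ->
  lam%:E < avg P (fun x => `|f x|%:E) ->
  ((lam / 8) `^ kappa * side P `^ d)%:E <=
  \esum_(i in [set i | [/\ A i, cube (Q i) `<=` cube P & lam < 8 * 2 ^ k i]%R])
     ((2 ^ k i) `^ kappa * side (Q i) `^ d)%:E.
Proof.
move=> lam0 kappa01 dE cov notsub; rewrite /avg lebesgue_cube/= => lamP.
have sP0 : (0 < side P ^+ n)%R by apply: exprn_gt0; exact: side_gt0.
have mP := @measurable_cube R n P.
pose B := [set i | A i /\ (lam < 8 * 2 ^ k i)%R].
pose G x : \bar R := \esum_(i in B) ((2 ^ k i)%:E * (\1_(cube (Q i)) x)%:E).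
have pow2_ge0 m : 0 <= (2 ^ m)%:E :> \bar R by rewrite lee_fin ltW// exp2z_gt0.
have term0 i x : 0 <= (2 ^ k i)%:E * (\1_(cube (Q i)) x)%:E :> \bar R.
  by rewrite mule_ge0.
have G0 x : 0 <= G x by apply: esum_ge0.
have fG x : `|f x|%:E <= (lam / 2)%:E + 4%:E * G x.
  have [fx|fx] := leP `|f x|%R (lam / 2)%R.
    by apply: (@le_trans _ _ (lam / 2)%:E); rewrite ?lee_fin// leeDl// mule_ge0.
  have fx0 : (0 < `|f x|)%R by apply: lt_trans fx; rewrite divr_gt0.
  (* Only [2^m <= |f x|] is known while [cov] asks for a strict inequality, so level [m - 1] is
     used; [lam / 2 < |f x| < 4 * 2^(m-1)] gives [lam < 8 * 2^(m-1)]. *)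
  have [m /andP[m1 m2]] := dyadic_floor fx0.
  have m1E : (2 ^ m = 2 * 2 ^ (m - 1) :> R)%R.
    by rewrite -[X in (X * _)%R]expr1z -exp2zD addrC subrK.
  have m2E : (2 ^ (m + 1) = 4 * 2 ^ (m - 1) :> R)%R.
    by rewrite exp2zD expr1z m1E; ring.
  have h0 := @exp2z_gt0 R (m - 1).
  have [|i [Ai ki Qi]] := cov (m - 1)%R x; first by lra.
  have Bi : B i by split => //; rewrite ki; lra.
  apply: (@le_trans _ _ (4%:E * G x)); last by rewrite leeDr// lee_fin; lra.
  apply: (@le_trans _ _ (4%:E * (2 ^ k i)%:E)).
    by rewrite -EFinM lee_fin ki; lra.
  rewrite lee_wpmul2l//.
  have := @le_esum_seq R _ B (fun i => (2 ^ k i)%:E * (\1_(cube (Q i)) x)%:E) [:: i].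
  rewrite big_seq1 indicE mem_set// mule1; apply => //.
  by move=> t; rewrite inE => /eqP ->.
have main : (lam * side P ^+ n)%:E <= (lam / 2 * side P ^+ n)%:E +
    4%:E * \esum_(i in B) ((2 ^ k i)%:E * lebesgue_rV R n (cube (Q i) `&` cube P)).
  apply: (@le_trans _ _ (\int[lebesgue_rV R n]_(x in cube P) `|f x|%:E)).
    by rewrite mulrC EFinM -lee_pdivlMl// ltW.
  rewrite EFinM -lebesgue_cube.
  have <- := @integral_affine_esum_indic _ _ _ (lebesgue_rV R n) _ i0 B (cube P)
    (fun i => 2 ^ k i)%R (fun i => cube (Q i)) (lam / 2) 4 mP
    (fun i => measurable_cube (Q i)) (fun i => ltW (exp2z_gt0 (k i)))
    (divr_ge0 (ltW lam0) (ler0n _ 2)) (ler0n _ 4).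
  exact: le_integral_nonneg.
have {}main : (lam / 8 * side P ^+ n)%:E <=
  \esum_(i in [set i | [/\ A i, cube (Q i) `<=` cube P & lam < 8 * 2 ^ k i]%R])
     (2 ^ k i * side (Q i) ^+ n)%:E.
  have : (lam / 8 * side P ^+ n)%:E <=
      \esum_(i in B) ((2 ^ k i)%:E * lebesgue_rV R n (cube (Q i) `&` cube P)).
    have : 0 <= \esum_(i in B) ((2 ^ k i)%:E * lebesgue_rV R n (cube (Q i) `&` cube P)).
      by apply: esum_ge0 => i _; rewrite mule_ge0.
    move: main; case: (\esum_(i in B) _) => [r| |]//; last by move=> _ _; rewrite leey.
    by rewrite -EFinM -EFinD !lee_fin; lra.
  move=> /le_trans; apply.
  rewrite (@esumID _ _ [set i | cube (Q i) `<=` cube P])//; last first.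
    by move=> i _; rewrite mule_ge0.
  rewrite [X in _ + X]esum1 ?adde0.
    apply: (@le_trans _ _ (\esum_(i in B `&` [set i | cube (Q i) `<=` cube P])
       (2 ^ k i * side (Q i) ^+ n)%:E)).
      apply: le_esum => i [_ QP]; rewrite setIidl// EFinM.
      by rewrite lee_wpmul2l// -lebesgue_cube.
    by apply: le_esum_subset => i [[Ai li] QP].
  move=> i [[Ai li] /= QP].
  rewrite [X in lebesgue_rV R n X](_ : _ = set0) ?measure0 ?mule0//.
  rewrite -subset0 => x [Qx Px].
  (* A covering cube that meets [P] without lying in it contains [P], which [notsub] excludes. *)
  have [PQ|/ltW QP'] := leP P.1 (Q i).1.
    by apply: QP; exact: cube_nested PQ Px Qx.
  by have := notsub i Ai li QP'; apply; exact: cube_nested QP' Qx Px.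
have kap0 : (0 <= kappa)%R by case/andP: kappa01 => /ltW.
have powE (c : R) (Q' : dyadic n) : (0 <= c)%R ->
    (c * side Q' ^+ n)%:E `^ kappa = (c `^ kappa * side Q' `^ d)%:E.
  move=> c0; rewrite poweR_EFin powRM//; last by rewrite exprn_ge0// side_ge0.
  by rewrite -powR_mulrn ?side_ge0// -powRrM dE.
have lam80 : (0 <= lam / 8)%R by lra.
rewrite -powE//.
apply: (@le_trans _ _ ((\esum_(i in [set i |
   [/\ A i, cube (Q i) `<=` cube P & lam < 8 * 2 ^ k i]%R])
     (2 ^ k i * side (Q i) ^+ n)%:E) `^ kappa)).
  by apply: le_poweR => //; rewrite lee_fin mulr_ge0// ltW.
apply: le_trans (esum_poweR_le _ kappa01 _) _.
  by move=> i; rewrite lee_fin mulr_ge0// ?exprn_ge0 ?side_ge0// ltW// exp2z_gt0.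
by apply: le_esum => i _; rewrite powE// ltW// exp2z_gt0.
Qed.

End level_cover.

(** * Packing of selected cubes *)

Lemma powRD_gt0 (R : realType) (x r s : R) :
  0 < x -> x `^ (r + s) = x `^ r * x `^ s.
Proof. by move=> x0; rewrite powRD// (gt_eqF x0) implybT. Qed.

Lemma esum_finite_bound (R : realType) (T : choiceType) (X : set T) (g : T -> R) :
  finite_set X -> (forall i, 0 <= g i) ->
  exists M : R, (\esum_(i in X) (g i)%:E <= M%:E)%E.
Proof.
move=> finX g0; rewrite esum_fset//; last by move=> i _; rewrite lee_fin.
by rewrite fsbig_finite//= sumEFin; eexists.
Qed.

Section packing.
Context {R : realType} {n : nat}.
Variables (alpha d kappa p : R).
Hypotheses (alpha_ge0 : 0 <= alpha) (alpha_lt : alpha < n%:R).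
Hypotheses (kappa_gt0 : 0 < kappa) (kappa_lt : kappa < p).
Hypothesis dE : d = n%:R * kappa.
(* [A] indexes the covering cubes [Q i] of the sets {|f| > 2^(k i)}; [a i] stands
   for the average of v over [Q i], and [beta P] for the lower bound of v on [P]
   provided by the cube [P] itself. *)
Variables (T : countType) (A : set T) (k : T -> int) (Q : T -> dyadic n).
Variables (a : T -> \bar R) (beta : dyadic n -> \bar R).
Hypothesis a_ge0 : forall i, (0 <= a i)%E.
Hypothesis beta_ge0 : forall P, (0 <= beta P)%E.
Local Notation side := (@side R n).
Local Notation cube := (@cube R n).
Hypothesis beta_le : forall i P, A i -> cube (Q i) `<=` cube P -> (beta P <= a i)%E.

(** The value that the average of [|f|] over [P] must exceed for [P] to witness a maximal function
    above [2^m]. *)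
Definition threshold m P : R := 2 ^ m * side P `^ (- alpha).

Definition mass i : \bar R := (((2 ^ k i) `^ p * side (Q i) `^ d)%:E * a i)%E.

(** In the application this is [2^(m p)] times the power [p/q] of the term of [P] in the content on
    the left-hand side; see [cost_content]. *)
Definition cost (m : int) P : \bar R :=
  (((2 ^ m) `^ p)%:E * (beta P * (side P `^ (d - alpha * p))%:E))%E.

Definition inner m P := [set i | [/\ A i, cube (Q i) `<=` cube P &
   threshold m P < 8 * 2 ^ k i]].

(* All that is kept of avg_P |f| > threshold m P when no covering cube of level
   above threshold m P / 8 contains [P]; this condition is monotone in m. *)
Definition selected m := [set P | (((threshold m P / 8) `^ kappa * side P `^ d)%:E <=
  \esum_(i in inner m P) ((2 ^ k i) `^ kappa * side (Q i) `^ d)%:E)%E].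

Let pow2_gt0 (m : int) : 0 < (2 : R) ^ m. Proof. exact: exp2z_gt0. Qed.
Let th0 : 0 < p - kappa. Proof. by rewrite subr_gt0. Qed.
Let p0 : 0 < p. Proof. exact: lt_trans kappa_lt. Qed.

Lemma threshold_gt0 m P : 0 < threshold m P.
Proof. by rewrite mulr_gt0// powR_gt0// side_gt0. Qed.

Lemma le_threshold m P P' : (P.1 <= P'.1)%R -> threshold m P <= threshold m P'.
Proof.
move=> PP'; rewrite /threshold ler_wpM2l ?(ltW (pow2_gt0 _))// !powRN.
rewrite lef_pV2 ?posrE ?powR_gt0 ?side_gt0//.
by apply: ge0_ler_powR; rewrite ?nnegrE ?side_ge0// le_side.
Qed.

Lemma threshold_double m m' P : (m < m')%R -> threshold m P <= threshold m' P / 2.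
Proof.
move=> mm'; rewrite /threshold mulrAC ler_wpM2r ?powR_ge0//.
rewrite ler_pdivlMr// -[X in _ * X](expr1z (2 : R)) -exp2zD ler_exp2z.
by rewrite lezD1.
Qed.

Lemma mass_ge0 i : (0 <= mass i)%E.
Proof. by rewrite mule_ge0// lee_fin mulr_ge0// powR_ge0. Qed.

Lemma cost_ge0 m P : (0 <= cost m P)%E.
Proof. by rewrite !mule_ge0// lee_fin powR_ge0. Qed.

Lemma costE m P :
  cost m P = ((threshold m P `^ p * side P `^ d)%:E * beta P)%E.
Proof.
rewrite /cost muleCA -EFinM muleC; congr (_%:E * _)%E.
rewrite powRM ?powR_ge0 ?ltW// -powRrM mulNr powRD_gt0 ?side_gt0//; ring.
Qed.

(** Split [threshold^p] into the powers [p - kappa] and [kappa]: the hypothesis bounds the second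
    factor, and [beta P <= a i] goes inside the sum. General [J] and [K] allow finitely many
    covering cubes to be discarded for a factor 2. *)
Lemma cost_le_mass m P (J : set T) (K : R) : 0 <= K ->
  J `<=` [set i | A i /\ cube (Q i) `<=` cube P] ->
  (((threshold m P / 8) `^ kappa * side P `^ d)%:E <=
     K%:E * \esum_(i in J) ((2 ^ k i) `^ kappa * side (Q i) `^ d)%:E)%E ->
  (cost m P <= (K * 8 `^ kappa)%:E *
     \esum_(i in J) (((threshold m P / 2 ^ k i) `^ (p - kappa))%:E * mass i))%E.
Proof.
move=> K0 JA h; have l0 := threshold_gt0 m P.
have t0 i : (0 <= ((2 ^ k i) `^ kappa * side (Q i) `^ d)%:E)%E.
  by rewrite lee_fin mulr_ge0 ?powR_ge0.
rewrite costE.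
have -> : threshold m P `^ p * side P `^ d =
    (8 `^ kappa * threshold m P `^ (p - kappa)) *
    ((threshold m P / 8) `^ kappa * side P `^ d).
  have E : threshold m P `^ kappa = 8 `^ kappa * (threshold m P / 8) `^ kappa.
    by rewrite -powRM ?divr_ge0 ?(ltW l0)// mulrC divfK.
  have -> : threshold m P `^ p =
      threshold m P `^ (p - kappa) * threshold m P `^ kappa.
    by rewrite -powRD_gt0// subrK.
  by rewrite E; ring.
apply: (@le_trans _ _ ((8 `^ kappa * threshold m P `^ (p - kappa))%:E * (beta P *
   (K%:E * \esum_(i in J) ((2 ^ k i) `^ kappa * side (Q i) `^ d)%:E)))%E).
  rewrite EFinM -muleA lee_wpmul2l ?lee_fin ?mulr_ge0 ?powR_ge0//.
  by rewrite muleC lee_wpmul2l.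
have -> : ((8 `^ kappa * threshold m P `^ (p - kappa))%:E * (beta P *
   (K%:E * \esum_(i in J) ((2 ^ k i) `^ kappa * side (Q i) `^ d)%:E)) =
   (K * 8 `^ kappa)%:E * \esum_(i in J) ((threshold m P `^ (p - kappa))%:E *
     (beta P * ((2 ^ k i) `^ kappa * side (Q i) `^ d)%:E)))%E.
  rewrite !esumZl ?lee_fin ?powR_ge0//; last by move=> i; rewrite mule_ge0.
  rewrite (muleCA (beta P)) !muleA -!EFinM; congr (_%:E * _ * _)%E.
  by ring.
rewrite lee_wpmul2l ?lee_fin ?mulr_ge0 ?powR_ge0//.
apply: le_esum => i /JA[Ai QP]; rewrite /mass.
have k0 := pow2_gt0 (k i).
rewrite (muleA _ _ (a i)) -EFinM.
have -> : (threshold m P / 2 ^ k i) `^ (p - kappa) * ((2 ^ k i) `^ p * side (Q i) `^ d) =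
    threshold m P `^ (p - kappa) * ((2 ^ k i) `^ kappa * side (Q i) `^ d).
  have -> : (2 ^ k i) `^ p = (2 ^ k i) `^ (p - kappa) * (2 ^ k i) `^ kappa :> R.
    by rewrite -powRD_gt0// subrK.
  rewrite -mulrA mulrA -powRM ?divr_ge0 ?(ltW l0) ?(ltW k0)// divfK// gt_eqF//.
rewrite [leRHS]muleC [in leRHS](EFinM (threshold m P `^ _)) [leRHS]muleCA.
rewrite lee_wpmul2l ?lee_fin ?powR_ge0//.
apply: lee_wpmul2r => //.
exact: beta_le.
Qed.

(** * Selected cubes and the maximal ones among them *)

Lemma cost_selected m P : selected m P ->
  (cost m P <= (8 `^ kappa)%:E *
     \esum_(i in inner m P) (((threshold m P / 2 ^ k i) `^ (p - kappa))%:E * mass i))%E.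
Proof.
move=> sP; rewrite -[X in X%:E]mul1r; apply: cost_le_mass => //.
  by move=> i [Ai QP _].
by rewrite mul1e.
Qed.

(** Lowering [m] lowers the threshold, which decreases the left side of the selection inequality and
    enlarges [inner]. *)
Lemma selected_anti m m' P : (m < m')%R -> selected m' P -> selected m P.
Proof.
move=> mm'; rewrite /selected/= => h.
have lmm' : threshold m P <= threshold m' P.
  by apply: le_trans (threshold_double _ mm') _; have := threshold_gt0 m' P; lra.
apply: le_trans (le_trans _ h) _.
  rewrite lee_fin ler_wpM2r ?powR_ge0//.
  have l8 m0 : 0 <= threshold m0 P / 8 by rewrite divr_ge0// ltW// threshold_gt0.
  apply: ge0_ler_powR; rewrite ?nnegrE ?l8 ?(ltW kappa_gt0)//.
  by rewrite ler_pM2r// invr_gt0.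
apply: le_esum_subset => i [Ai QP li]; split => //.
exact: le_lt_trans li.
Qed.

(** A larger first component means a smaller side: no selected cube containing [P] has a larger
    side. *)
Definition maximal_selected m := [set P | selected m P /\
  forall P', selected m P' -> cube P `<=` cube P' -> (P.1 <= P'.1)%R].

(** [P'] is also selected at the lower level [m], and both cubes contain [Q i], hence are nested; a
    larger [P'] would contradict the maximality of [P]. *)
Lemma maximal_selected_le m m' P P' i :
  (m <= m')%R -> maximal_selected m P -> maximal_selected m' P' ->
  cube (Q i) `<=` cube P -> cube (Q i) `<=` cube P' -> (P.1 <= P'.1)%R.
Proof.
move=> mm' [sP maxP] [sP' _] QP QP'; rewrite leNgt; apply/negP => PP'.
have [x Qx] := @cube_neq0 R n (Q i).
suff : (P.1 <= P'.1)%R by rewrite leNgt PP'.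
apply: maxP.
  move: mm'; rewrite le_eqVlt => /predU1P[->//|mm'].
  exact: selected_anti sP'.
by apply: cube_nested (QP' _ Qx) (QP _ Qx); exact: ltW.
Qed.

Lemma esum_subsingleton (U : choiceType) (W : set U) (g : U -> \bar R) (x : U) :
  (forall y, (0 <= g y)%E) -> (forall y, W y -> y = x) ->
  (\esum_(y in W) g y <= g x)%E.
Proof.
move=> g0 Wx; apply: le_trans (le_esum_subset _ (_ : W `<=` [set x])) _ => //.
by rewrite esum_set1.
Qed.

(** With [i] outermost, each [m] contributes at most one maximal cube around [Q i]. As [m] grows
    these cubes do not grow, so the ratios [threshold / 2^(k i)], all below 8, at least double and
    [esum_geometric] applies. *)
Lemma esum_maximal_selected :
  (\esum_(m in [set: int]) \esum_(P in maximal_selected m) cost m P <=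
   (8 `^ kappa * geometric_const 8 (p - kappa))%:E * \esum_(i in A) mass i)%E.
Proof.
pose W i m := maximal_selected m `&` [set P | inner m P i].
pose th := p - kappa.
pose t m i P := (((threshold m P / 2 ^ k i) `^ th)%:E * mass i)%E.
have t0 m i P : (0 <= t m i P)%E.
  by rewrite mule_ge0 ?mass_ge0// lee_fin powR_ge0.
apply: (@le_trans _ _ (\esum_(m in [set: int]) \esum_(P in maximal_selected m)
    ((8 `^ kappa)%:E * \esum_(i in inner m P) t m i P))%E).
  apply: le_esum => m _; apply: le_esum => P [sP _].
  exact: cost_selected.
have t0' m P J : (0 <= \esum_(i in J) t m i P)%E by apply: esum_ge0.
rewrite (@eq_esum _ _ _ _ (fun m => (8 `^ kappa)%:E *
    \esum_(i in A) \esum_(P in W i m) t m i P)%E); last first.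
  move=> m _; rewrite esumZl ?lee_fin ?powR_ge0//; congr (_ * _)%E.
  apply: esum_swap => [P i //|P i]; split.
    by move=> [mP iP]; split => //; case: iP.
  by move=> [Ai [mP iP]].
rewrite esumZl ?lee_fin ?powR_ge0//; last first.
  by move=> m; apply: esum_ge0 => i _; exact: esum_ge0.
rewrite EFinM -muleA lee_wpmul2l ?lee_fin ?powR_ge0//.
rewrite (@esum_swap _ _ _ _ _ A (fun=> [set: int])) => [|m i|m i]; last 2 first.
- exact: esum_ge0.
- by split => [[]|[]].
have K0 : 0 <= geometric_const 8 th :> R by exact: geometric_const_ge0.
rewrite -esumZl ?lee_fin//; last exact: mass_ge0.
apply: le_esum => i Ai.
have subW m m' P P' : (m <= m')%R -> W i m P -> W i m' P' -> (P.1 <= P'.1)%R.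
  move=> mm' [mP [_ QP _]] [mP' [_ QP' _]].
  exact: maximal_selected_le mP mP' QP QP'.
have uniqW m P P' : W i m P -> W i m P' -> P' = P.
  move=> WP WP'; have [x Qx] := @cube_neq0 R n (Q i).
  apply: (@cube_uniq R n _ _ x).
  - by apply/eqP; rewrite eq_le (subW _ _ _ _ _ WP' WP) ?(subW _ _ _ _ _ WP WP').
  - by case: WP' => _ [_ /(_ _ Qx)].
  - by case: WP => _ [_ /(_ _ Qx)].
(* The default 0 at levels without a cube contributes nothing, since the exponent [th] is
   positive. *)
pose u m : R := if pselect (W i m !=set0) is left ex then
  threshold m (projT1 (cid ex)) / 2 ^ k i else 0.
have uE m P : W i m P -> u m = threshold m P / 2 ^ k i.
  rewrite /u => WP; case: pselect => [ex|[]]; last by exists P.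
  case: (cid ex) => P' WP' /=.
  by rewrite (uniqW _ _ _ WP WP').
have u_ge0 m : 0 <= u m.
  rewrite /u; case: pselect => // ex; rewrite divr_ge0// ltW//.
  exact: threshold_gt0.
have uW m : 0 < u m -> exists P, W i m P.
  by rewrite /u; case: pselect => [[P WP] _|_]; [exists P|rewrite ltxx].
have geo : (\esum_(m in [set: int]) (u m `^ th)%:E <= (geometric_const 8 th)%:E)%E.
  apply: esum_geometric => // [m|m m' mm' /uW[P' WP']].
    rewrite u_ge0/= leNgt; apply/negP => u8.
    have /uW[P WP] : 0 < u m by apply: lt_trans u8.
    move: u8; apply/negP; rewrite -leNgt (uE _ _ WP).
    by case: WP => _ [_ _ li]; rewrite ler_pdivrMr// ltW.
  rewrite (uE _ _ WP').
  have := u_ge0 m; rewrite le_eqVlt => /predU1P[<-|/uW[P WP]].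
    by rewrite !divr_ge0// ltW// threshold_gt0.
  rewrite (uE _ _ WP) [leRHS]mulrAC ler_wpM2r ?invr_ge0 ?(ltW (pow2_gt0 _))//.
  apply: le_trans (threshold_double _ mm') _.
  rewrite ler_wpM2r ?invr_ge0//; apply: le_threshold.
  exact: subW (ltW mm') WP WP'.
apply: (@le_trans _ _ (\esum_(m in [set: int]) (mass i * (u m `^ th)%:E))%E).
  apply: le_esum => m _.
  have [[P WP]|nW] := pselect (W i m !=set0); last first.
    have -> : W i m = set0.
      by apply/seteqP; split => // P WP; apply: nW; exists P.
    by rewrite esum_set0 mule_ge0 ?mass_ge0// lee_fin powR_ge0.
  apply: le_trans (@esum_subsingleton _ _ _ P _ _) _ => //.
    by move=> P'; exact: uniqW.
  by rewrite /t (uE _ _ WP) muleC.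
rewrite esumZl ?mass_ge0//; last by move=> m; rewrite lee_fin powR_ge0.
by rewrite muleC lee_wpmul2r// mass_ge0.
Qed.

(** * Selected cubes without a maximal one above them *)

Lemma threshold_side_unbounded m (M : R) :
  exists N : int, forall P, (P.1 <= N)%R ->
    M <= (threshold m P / 8) `^ kappa * side P `^ d.
Proof.
(* Since [d = n kappa], this is the total exponent of the side; it is positive because
   [alpha < n]. *)
pose ex := kappa * (n%:R - alpha).
have ex0 : 0 < ex by rewrite mulr_gt0// subr_gt0.
pose c0 : R := (2 ^ m / 8) `^ kappa.
have c00 : 0 < c0 by rewrite powR_gt0// divr_gt0.
have E P : (threshold m P / 8) `^ kappa * side P `^ d = c0 * side P `^ ex.
  rewrite /threshold mulrAC powRM ?powR_ge0 ?divr_ge0 ?(ltW (pow2_gt0 _))//.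
  rewrite -/c0 -mulrA -powRrM -powRD_gt0 ?side_gt0//; congr (_ * _ `^ _).
  by rewrite /ex dE; ring.
pose y := (`|M| + 1) / c0.
have y0 : 0 < y by rewrite divr_gt0// ltr_wpDl.
have [z /andP[_ rz]] := dyadic_floor (powR_gt0 ex^-1 y0).
exists (- (z + 1))%R => P PN; rewrite E.
have rs : y `^ ex^-1 <= side P.
  by apply: le_trans (ltW rz) _; rewrite /side ler_exp2z lerNr.
have : y <= side P `^ ex.
  rewrite -[y](powRr1 (ltW y0)) -(mulVf (negbT (gt_eqF ex0))) powRrM.
  by apply: ge0_ler_powR => //; rewrite ?nnegrE ?powR_ge0 ?side_ge0 ?(ltW ex0).
rewrite ler_pdivrMr// mulrC; apply: le_trans.
by apply: le_trans (ler_norm M) _; rewrite lerDl.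
Qed.

(* By [threshold_side_unbounded], finitely many covering cubes account for at most
   half of the selection inequality of a large cube, so that its cost is bounded
   by a tail of the convergent sum of the masses. *)
Lemma cost_unbounded m P e : (\esum_(i in A) mass i < +oo)%E -> 0 < e ->
  (forall N : int, exists P',
     [/\ selected m P', (P'.1 <= N)%R & cube P `<=` cube P']) ->
  exists P', [/\ selected m P', cube P `<=` cube P' & (cost m P' <= e%:E)%E].
Proof.
move=> Sfin e0 unb.
(* The 2 pays for discarding [X], [8^kappa] comes from [cost_le_mass], and [8^(p - kappa)] from the
   ratios below 8. *)
pose K := 2 * 8 `^ kappa * 8 `^ (p - kappa) : R.
have K0 : 0 < K by rewrite !mulr_gt0// powR_gt0.
have [X finX tailX] := esum_tail mass_ge0 Sfin (divr_gt0 e0 K0).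
pose t i : R := (2 ^ k i) `^ kappa * side (Q i) `^ d.
have t0 i : 0 <= t i by rewrite mulr_ge0 ?powR_ge0.
have [M hM] := esum_finite_bound finX t0.
(* With the left side at least [2 M], the indices in [X] account for at most half of it. *)
have [N hN] := threshold_side_unbounded m (2 * M).
have [P' [sP' P'N PP']] := unb N; exists P'; split => //.
have {}hN := hN _ P'N.
pose J := inner m P' `\` X.
have h : (((threshold m P' / 8) `^ kappa * side P' `^ d)%:E <=
    2%:E * \esum_(i in J) (t i)%:E)%E.
  have J0 : (0 <= \esum_(i in J) (t i)%:E)%E.
    by apply: esum_ge0 => i _; rewrite lee_fin.
  have : (((threshold m P' / 8) `^ kappa * side P' `^ d)%:E <=
      M%:E + \esum_(i in J) (t i)%:E)%E.
    apply: le_trans sP' _; rewrite (esumID X);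
      last by move=> i _; rewrite lee_fin; exact: t0.
    rewrite leeD//; apply: le_trans hM.
    by apply: le_esum_subset => i [].
  case: (\esum_(i in J) _) J0 => [r|_|//].
    by rewrite -EFinD -EFinM !lee_fin => r0 ?; lra.
  by rewrite gt0_muley ?lte_fin// leey.
apply: le_trans (cost_le_mass _ _ h) _ => //.
  by move=> i [[]].
have -> : e = (2 * 8 `^ kappa) * (8 `^ (p - kappa) * (e / K)).
  by rewrite mulrA -/K mulrCA divff ?mulr1// gt_eqF.
rewrite [leRHS]EFinM lee_wpmul2l ?lee_fin ?mulr_ge0 ?powR_ge0//.
rewrite [leRHS]EFinM; apply: le_trans (lee_wpmul2l _ tailX); last first.
  by rewrite lee_fin powR_ge0.
rewrite -esumZl ?lee_fin ?powR_ge0//; last exact: mass_ge0.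
apply: (@le_trans _ _ (\esum_(i in J) ((8 `^ (p - kappa))%:E * mass i))%E).
  apply: le_esum => i [[Ai _ li] _].
  apply: lee_wpmul2r; first exact: mass_ge0.
  rewrite lee_fin; apply: ge0_ler_powR; rewrite ?nnegrE ?(ltW th0)//.
    by rewrite divr_ge0// ltW// threshold_gt0.
  by rewrite ler_pdivrMr// ltW.
by apply: le_esum_subset => i [[]].
Qed.

(** If the selected cubes above [P] have bounded side, their first components are bounded below by
    some [N]; a cube with the least offset from [N] is maximal. *)
Lemma selected_maximal_or_unbounded m P : selected m P ->
  (exists2 P', maximal_selected m P' & cube P `<=` cube P') \/
  (forall N : int, exists P',
     [/\ selected m P', (P'.1 <= N)%R & cube P `<=` cube P']).
Proof.
move=> sP; have [h|] := pselect (forall N : int, exists P',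
     [/\ selected m P', (P'.1 <= N)%R & cube P `<=` cube P']); first by right.
move=> /existsNP[N hN]; left.
have lN P' : selected m P' -> cube P `<=` cube P' -> (N <= P'.1)%R.
  move=> sP' PP'; rewrite leNgt; apply/negP => P'N; apply: hN.
  by exists P'; split => //; exact: ltW.
pose D (j : nat) := `[< exists P', [/\ selected m P', cube P `<=` cube P' &
  P'.1 = N + j%:Z] >].
have exD : exists j, D j.
  exists `|P.1 - N|%N; apply/asboolP; exists P; split => //.
  by rewrite gez0_abs ?subr_ge0 ?lN// subrKC.
case: (ex_minnP exD) => j /asboolP[P' [sP' PP' P'j]] minj.
exists P' => //; split => // P'' sP'' P'P''.
have PP'' : cube P `<=` cube P'' by exact: subset_trans P'P''.
have NP'' := lN _ sP'' PP''.
rewrite P'j -lerBrDl -[leRHS]gez0_abs ?subr_ge0//.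
rewrite lez_nat minj//; apply/asboolP; exists P''; split => //.
by rewrite gez0_abs ?subr_ge0// subrKC.
Qed.

(** To the maximal cubes one adds, for every pair [(m, P)] of the unbounded kind, a cube above [P]
    of cost at most [g (m, P)]; there are countably many pairs and these budgets add up to at most
    [e]. *)
Lemma selected_cover e : (\esum_(i in A) mass i < +oo)%E -> 0 < e ->
  exists F : int -> set (dyadic n),
    (forall m P, selected m P -> exists2 P', F m P' & cube P `<=` cube P') /\
    (\esum_(m in [set: int]) \esum_(P in F m) cost m P <=
     (8 `^ kappa * geometric_const 8 (p - kappa))%:E *
       (\esum_(i in A) mass i) + e%:E)%E.
Proof.
move=> Sfin e0.
have [g g0 ge] := @esum_epsilon R (int * dyadic n)%type e e0.
pose U m := [set P | selected m P /\ forall N : int, exists P',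
     [/\ selected m P', (P'.1 <= N)%R & cube P `<=` cube P']].
have /choice[phi hphi] : forall mP : int * dyadic n, exists P', U mP.1 mP.2 ->
    cube mP.2 `<=` cube P' /\ (cost mP.1 P' <= (g mP)%:E)%E.
  move=> [m P]; have [[sP unb]|nU] := pselect (U m P); last by exists P.
  have [P' [_ PP' cP']] := cost_unbounded Sfin (g0 (m, P)) unb.
  by exists P'.
exists (fun m => maximal_selected m `|` (fun P => phi (m, P)) @` U m); split.
  move=> m P sP; have [[P' mP' PP']|unb] := selected_maximal_or_unbounded sP.
    by exists P' => //; left.
  have UP : U m P by [].
  by exists (phi (m, P)); [right; exists P|have [] := hphi (m, P) UP].
apply: (@le_trans _ _ (\esum_(m in [set: int]) (\esum_(P in maximal_selected m) cost m P +
    \esum_(P in U m) (g (m, P))%:E))%E).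
  apply: le_esum => m _; apply: le_trans (le_esumU _ _ (cost_ge0 m)) _.
  rewrite leeD2l//; apply: le_trans (le_esum_image _ _ (cost_ge0 m)) _.
  by apply: le_esum => P UP; have [] := hphi (m, P) UP.
rewrite esumD; last 2 first.
- by move=> m _; apply: esum_ge0 => P _; exact: cost_ge0.
- by move=> m _; apply: esum_ge0 => P _; rewrite lee_fin ltW.
apply: leeD; first exact: esum_maximal_selected.
apply: le_trans ge.
rewrite (esum_esum (a := fun m P => (g (m, P))%:E)); last first.
  by move=> m P _ _; rewrite lee_fin ltW.
apply: le_trans (le_esum_subset _ (@subsetT _ _)) _.
by apply: le_esum => -[].
Qed.

(** Covering cubes that may replace, at level [m], the witnesses lying inside them. *)
Definition oversized m := [set i | A i /\ threshold m (Q i) < 8 * 2 ^ k i].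

(** For fixed [i] the cube does not vary with [m], so the ratios [threshold m (Q i) / 2^(k i)]
    double at each step and stay below 8; the series is geometric with exponent [p]. *)
Lemma esum_oversized :
  (\esum_(m in [set: int]) \esum_(i in oversized m) cost m (Q i) <=
   (geometric_const 8 p)%:E * \esum_(i in A) mass i)%E.
Proof.
rewrite (@esum_swap _ _ _ _ _ A (fun i => [set m | oversized m i]));
  last 2 first.
- by move=> m i; exact: cost_ge0.
- by move=> m i; split => [[_ bi]|[_ bi]//]; split => //; case: bi.
have K0 : 0 <= geometric_const 8 p :> R by exact: geometric_const_ge0.
rewrite -esumZl ?lee_fin//; last exact: mass_ge0.
apply: le_esum => i Ai.
pose u m : R :=
  if threshold m (Q i) < 8 * 2 ^ k i then threshold m (Q i) / 2 ^ k i else 0.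
have u_le m : u m <= threshold m (Q i) / 2 ^ k i.
  by rewrite /u; case: ifP => // _; rewrite divr_ge0// ltW// threshold_gt0.
have u_ge0 m : 0 <= u m.
  by rewrite /u; case: ifP => // _; rewrite divr_ge0// ltW// threshold_gt0.
have geo : (\esum_(m in [set: int]) (u m `^ p)%:E <= (geometric_const 8 p)%:E)%E.
  apply: esum_geometric => // [m|m m' mm'].
    rewrite u_ge0/= /u; case: ifP => // li.
    by rewrite ler_pdivrMr// ltW.
  move=> um'0; have -> : u m' = threshold m' (Q i) / 2 ^ k i.
    by move: um'0; rewrite /u; case: ifP => //; rewrite ltxx.
  apply: le_trans (u_le m) _.
  rewrite [leRHS]mulrAC ler_wpM2r ?invr_ge0 ?(ltW (pow2_gt0 _))//.
  exact: threshold_double.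
apply: (@le_trans _ _ (\esum_(m in [set: int]) (mass i * (u m `^ p)%:E))%E).
  apply: (@le_trans _ _ (\esum_(m in [set m | oversized m i])
      (mass i * (u m `^ p)%:E))%E);
    last exact: le_esum_subset.
  apply: le_esum => m [_ li]; rewrite costE /u li /mass.
  rewrite muleAC -EFinM.
  have -> : (2 ^ k i) `^ p * side (Q i) `^ d * (threshold m (Q i) / 2 ^ k i) `^ p =
      threshold m (Q i) `^ p * side (Q i) `^ d.
    rewrite mulrAC -powRM ?divr_ge0 ?(ltW (pow2_gt0 _)) ?(ltW (threshold_gt0 _ _))//.
    by rewrite (mulrC (2 ^ k i)) divfK// gt_eqF.
  by rewrite lee_wpmul2l ?beta_le// lee_fin mulr_ge0 ?powR_ge0.
rewrite esumZl ?mass_ge0//; last by move=> m; rewrite lee_fin powR_ge0.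
by rewrite muleC lee_wpmul2r// mass_ge0.
Qed.

End packing.

(** * Contents and maximal functions *)

Section hausdorff_content.
Context {R : realType} {n : nat}.
Variables (s : R) (v : 'rV[R]_n -> \bar R).
Hypothesis v_ge0 : forall x, (0 <= v x)%E.
Local Open Scope ereal_scope.
Local Notation side := (@side R n).
Local Notation cube := (@cube R n).

Let cost_ge0 (Q : dyadic n) : 0 <= avg Q v * (side Q `^ s)%:E.
Proof. by rewrite mule_ge0 ?avg_ge0// lee_fin powR_ge0. Qed.

Lemma hausdorff_content_ge0 E : 0 <= hausdorff_content s v E.
Proof.
apply: le_ereal_inf_tmp => _ [J [Q [_ ->]]].
exact: nneseries_ge0.
Qed.

Lemma le_hausdorff_content E E' : E `<=` E' ->
  hausdorff_content s v E <= hausdorff_content s v E'.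
Proof.
move=> EE'; apply: ereal_inf_le_tmp => _ [J [Q [E'Q ->]]].
by exists J, Q; split => //; exact: subset_trans E'Q.
Qed.

Lemma hausdorff_content_cover E (G : set (dyadic n)) :
  E `<=` \bigcup_(P in G) cube P ->
  hausdorff_content s v E <= \esum_(P in G) (avg P v * (side P `^ s)%:E).
Proof.
move=> EG; have [J [h [GE ->]]] := @esum_countE R (int * 'rV[int]_n)%type (0%R, 0%R) G;
  last by [].
apply: ereal_inf_lbound; exists J, h; split => // x /EG[P GP Px].
have [j Jj jP] := (GE P).1 GP.
by exists j => //; rewrite jP.
Qed.

Lemma hausdorff_content_adherent E (e : R) :
  hausdorff_content s v E < +oo -> (0 < e)%R ->
  exists (J : pred nat) (Q : nat -> dyadic n),
    E `<=` \bigcup_(j in [set j | J j]) cube (Q j) /\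
    \esum_(j in [set j | J j]) (avg (Q j) v * (side (Q j) `^ s)%:E) <=
      hausdorff_content s v E + e%:E.
Proof.
move=> Efin e0.
have [|_ [J [Q [EQ ->]]] lt] := lb_ereal_inf_adherent e0
    (_ : hausdorff_content s v E \is a fin_num).
  by rewrite ge0_fin_numE// hausdorff_content_ge0.
by exists J, Q; split => //; rewrite -nneseries_esum// ltW.
Qed.

End hausdorff_content.

Section dyadic_maximal.
Context {R : realType} {n : nat}.
Local Open Scope ereal_scope.
Local Notation side := (@side R n).
Local Notation cube := (@cube R n).

Lemma le_dyadic_maximal (b : R) (f : 'rV[R]_n -> R) P x : cube P x ->
  avg P (fun y => `|f y|%:E) * (side P `^ b)%:E <= dyadic_maximal b f x.
Proof.
move=> Px; apply: ereal_sup_ubound; exists P => //.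
by rewrite indicE mem_set// mul1e.
Qed.

Lemma dyadic_maximal_ge0 (b : R) (f : 'rV[R]_n -> R) x : 0 <= dyadic_maximal b f x.
Proof.
have a0 : 0 <= @avg R n (0%R, 0%R) (fun y => `|f y|%:E).
  by apply: avg_ge0 => y; rewrite lee_fin.
apply: (@le_trans _ _ ((\1_(cube (0%R, 0%R)) x)%:E *
    avg (0%R, 0%R) (fun y => `|f y|%:E) * (side (0%R, 0%R) `^ b)%:E)).
  by rewrite mule_ge0 ?lee_fin ?powR_ge0// mule_ge0// lee_fin.
by apply: ereal_sup_ubound; exists (0%R, 0%R).
Qed.

Lemma lt_dyadic_maximal (b t : R) (f : 'rV[R]_n -> R) x : (0 <= t)%R ->
  t%:E < dyadic_maximal b f x ->
  exists2 P, cube P x &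
    (t * side P `^ (- b))%:E < avg P (fun y => `|f y|%:E).
Proof.
move=> t0 /ereal_sup_gt[_ [P _ <-]] h; exists P.
  (* Outside [P] the indicator makes the term 0, which cannot exceed [t >= 0]. *)
  apply: contrapT => nPx; move: h.
  by rewrite indicE memNset// !mul0e lte_fin ltNge t0.
have s0 : (0 < side P `^ b)%R by rewrite powR_gt0// side_gt0.
rewrite powRN EFinM muleC lte_pdivrMl// muleC; apply: lt_le_trans h _.
rewrite -muleA -[leRHS]mul1e lee_wpmul2r//.
  by rewrite mule_ge0 ?avg_ge0// lee_fin ltW.
by rewrite lee_fin indicE; case: (_ \in _).
Qed.

End dyadic_maximal.

(** * The strong type inequality *)

Section strong_type.
Context {R : realType} {n : nat}.
Variables (d alpha gamma p q : R).
Hypotheses (n0 : (0 < n)%N) (d0 : 0 < d) (dn : d <= n%:R).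
Hypotheses (alpha0 : 0 <= alpha) (alphan : alpha < n%:R).
Hypotheses (dp : d / n%:R < p) (pq : p <= q).
Variables (w f : 'rV[R]_n -> R).
Hypothesis w0 : forall x, 0 <= w x.
Local Notation side := (@side R n).
Local Notation cube := (@cube R n).

Let delta := q / p * (d - (alpha - gamma) * p).
Let v x := (dyadic_maximal (gamma * q) w x `^ (p / q))%E.
Let kappa := d / n%:R.
(** The lower bound for [v] witnessed by [P]: the power [p/q] of its average of [w] times
    [l(P)^(gamma q)]. *)
Let beta (P : dyadic n) : \bar R :=
  (avg P (EFin \o w) `^ (p / q) * (side P `^ (gamma * p))%:E)%E.
Let E (t : R) := [set x : 'rV[R]_n | (t%:E < dyadic_maximal alpha f x)%E].
Let F (t : R) := [set x : 'rV[R]_n | t < `|f x|].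
Let C1 := 8 `^ kappa * geometric_const 8 (p - kappa) + geometric_const 8 p.

Let nR0 : 0 < n%:R :> R. Proof. by rewrite ltr0n. Qed.
Let kappa0 : 0 < kappa. Proof. exact: divr_gt0. Qed.
Let kappa1 : kappa <= 1. Proof. by rewrite ler_pdivrMr// mul1r. Qed.
Let dE : d = n%:R * kappa. Proof. by rewrite mulrC divfK// gt_eqF. Qed.
Let p0 : 0 < p. Proof. exact: lt_trans dp. Qed.
Let q0 : 0 < q. Proof. exact: lt_le_trans pq. Qed.
Let pq01 : 0 < p / q <= 1.
Proof. by rewrite divr_gt0//= ler_pdivrMr// mul1r. Qed.
Let pow2_gt0 (m : int) : 0 < (2 : R) ^ m. Proof. exact: exp2z_gt0. Qed.

Let v_ge0 x : (0 <= v x)%E. Proof. exact: poweR_ge0. Qed.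

Let w_ge0 x : (0 <= (EFin \o w) x)%E. Proof. by rewrite lee_fin. Qed.

Let beta_ge0 P : (0 <= beta P)%E.
Proof. by rewrite mule_ge0 ?poweR_ge0// lee_fin powR_ge0. Qed.

Let C1_ge0 : 0 <= C1.
Proof.
apply: addr_ge0; last exact: geometric_const_ge0.
by rewrite mulr_ge0 ?powR_ge0// geometric_const_ge0// subr_gt0.
Qed.

(* Every point of a cube [Q] contained in [P] sees [P] in the supremum defining
   the maximal function of [w]. *)
Let beta_le P Q : cube Q `<=` cube P -> (beta P <= avg Q v)%E.
Proof.
move=> QP; apply: le_avg => // x /QP Px.
have -> : beta P =
    ((avg P (fun y => `|w y|%:E) * (side P `^ (gamma * q))%:E) `^ (p / q))%E.
  have -> : (fun y => `|w y|%:E) = EFin \o w.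
    by apply/funext => y /=; rewrite ger0_norm.
  rewrite poweRM ?avg_ge0//; last by rewrite lee_fin powR_ge0.
  congr (_ * _)%E; rewrite poweR_EFin -powRrM; congr (_ `^ _)%:E.
  by field; rewrite gt_eqF.
apply: le_poweR; last exact: le_dyadic_maximal.
  by case/andP: pq01 => /ltW.
rewrite mule_ge0 ?lee_fin ?powR_ge0//.
by apply: avg_ge0 => y; rewrite lee_fin.
Qed.

(** The choice of [delta] enters here: [delta p / q = gamma p + (d - alpha p)]. *)
Let cost_content m P :
  (((2 ^ m) `^ p)%:E * (avg P (EFin \o w) * (side P `^ delta)%:E) `^ (p / q) =
   cost alpha d p beta m P)%E.
Proof.
rewrite /cost /beta; congr (_ * _)%E.
rewrite poweRM ?avg_ge0//; last by rewrite lee_fin powR_ge0.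
rewrite -muleA; congr (_ * _)%E.
rewrite -EFinM poweR_EFin -powRrM -powRD_gt0 ?side_gt0//.
congr (_ `^ _)%:E; rewrite /delta.
by field; rewrite !gt_eqF.
Qed.

(** At each level the selected cover and the oversized cubes together cover [E (2^m)]; their costs
    are summed by the packing bounds, whose constants add up to [C1]. *)
Lemma esum_maximal_level (J : int -> pred nat) (Qf : int -> nat -> dyadic n) e :
  let A := [set i : int * nat | J i.1 i.2] in
  let S := (\esum_(i in A) mass d p fst (fun i => Qf i.1 i.2)
              (fun i => avg (Qf i.1 i.2) v) i)%E in
  (forall m, F (2 ^ m) `<=` \bigcup_(j in [set j | J m j]) cube (Qf m j)) ->
  (S < +oo)%E -> 0 < e ->
  (\esum_(m in [set: int]) (((2 ^ m) `^ p)%:E *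
      hausdorff_content delta (EFin \o w) (E (2 ^ m)) `^ (p / q)) <=
   C1%:E * S + e%:E)%E.
Proof.
move=> A S cov Sfin e0.
pose k (i : int * nat) := i.1; pose Q (i : int * nat) := Qf i.1 i.2.
pose a i := avg (Q i) v.
have a0 i : (0 <= a i)%E by exact: avg_ge0.
have betaa i P : A i -> cube (Q i) `<=` cube P -> (beta P <= a i)%E.
  by move=> _; exact: beta_le.
have [G [selG sumG]] :=
  @selected_cover R n alpha d kappa p alpha0 alphan kappa0 dp dE _ A k Q a beta
    a0 beta_ge0 betaa e Sfin e0.
have sumB := @esum_oversized R n alpha d kappa p kappa0 dp _ A k Q a beta a0
  beta_ge0 betaa.
have coverE m : E (2 ^ m) `<=`
    \bigcup_(P in G m `|` Q @` oversized alpha A k Q m) cube P.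
  move=> x /(lt_dyadic_maximal (ltW (pow2_gt0 m)))[P Px hP].
  (* If a covering cube of level above [threshold m P / 8] contains the witness [P], passing to it
     can only lower the threshold, so it is oversized. Otherwise [avg_level_cover] makes [P]
     selected. *)
  have [[i [Ai li iP PQ]]|nbig] := pselect (exists i, [/\ A i,
      threshold alpha m P < 8 * 2 ^ k i, ((Q i).1 <= P.1)%R &
      cube P `<=` cube (Q i)]).
    exists (Q i); last exact: PQ.
    right; exists i => //; split => //; apply: le_lt_trans li.
    exact: le_threshold.
  have [P' GP' PP'] : exists2 P', G m P' & cube P `<=` cube P'.
    apply: selG; rewrite /selected/=.
    apply: (@avg_level_cover R n _ (0%R, 0%N) A k Q f P) => //.
    - exact: threshold_gt0.
    - by rewrite kappa0.
    - move=> m' y my; have [j Jj Qj] := cov m' y my.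
      by exists (m', j).
    - by move=> i Ai li iP PQ; apply: nbig; exists i.
  by exists P'; [left|exact: PP'].
have cost0 m P : (0 <= cost alpha d p beta m P)%E by exact: cost_ge0.
apply: (@le_trans _ _ (\esum_(m in [set: int]) (
    \esum_(P in G m) cost alpha d p beta m P +
    \esum_(i in oversized alpha A k Q m) cost alpha d p beta m (Q i)))%E).
  apply: le_esum => m _.
  apply: le_trans (leeD2l _ (le_esum_image _ _ (cost0 m))).
  apply: le_trans (le_esumU _ _ (cost0 m)).
  under eq_esum => P _ do rewrite -cost_content.
  rewrite esumZl ?lee_fin ?powR_ge0//; last by move=> P; exact: poweR_ge0.
  rewrite lee_wpmul2l ?lee_fin ?powR_ge0//.
  have c0 P : (0 <= avg P (EFin \o w) * (side P `^ delta)%:E)%E.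
    by rewrite mule_ge0 ?avg_ge0// lee_fin powR_ge0.
  (* Here [p <= q] is used: the power [p/q] of the content is at most the sum of the powers of the
     terms. *)
  apply: le_trans (esum_poweR_le _ pq01 c0).
  apply: le_poweR; [by case/andP: pq01 => /ltW|exact: hausdorff_content_ge0|].
  exact: hausdorff_content_cover.
rewrite esumD; last 2 first.
- by move=> m _; exact: esum_ge0.
- by move=> m _; exact: esum_ge0.
apply: le_trans (leeD sumG sumB) _.
have S0 : (0 <= S)%E by apply: esum_ge0 => i _; exact: mass_ge0.
rewrite /C1 EFinD [X in (_ <= X + _)%E]ge0_muleDl ?lee_fin; last 2 first.
- by rewrite mulr_ge0 ?powR_ge0// geometric_const_ge0// subr_gt0.
- exact: geometric_const_ge0.
by rewrite -!addeA leeD2l// addeC.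
Qed.

(** The outer factors come from [le_integral_level] and [ge_integral_level], the middle one from the
    packing. *)
Let C := 2 `^ p * (C1 * (2 * 2 `^ p)).

Let pow2p_ge0 : (0%:E <= ((2 : R) `^ p)%:E)%E. Proof. by rewrite lee_fin powR_ge0. Qed.

Lemma C_gt0 : 0 < C.
Proof.
rewrite !mulr_gt0 ?powR_gt0// ltr_wpDl//; last first.
  by rewrite mulr_gt0 ?powR_gt0// invr_gt0 geometric_gap.
by rewrite mulr_ge0 ?powR_ge0// geometric_const_ge0// subr_gt0.
Qed.

(** Unless the right-hand side is infinite, every content [HF (2^m)] is finite and has a nearly
    optimal covering; these coverings enter [esum_maximal_level], and the total error is arbitrarily
    small. *)
Lemma maximal_integral_le :
  (\int[lebesgue_measure]_(t in `]0%R, +oo[)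
     (((t `^ q)%:E * hausdorff_content delta (EFin \o w) (E t)) `^ (p / q) *
      (t^-1)%:E) <=
   C%:E * \int[lebesgue_measure]_(t in `]0%R, +oo[)
     (((t `^ p)%:E * hausdorff_content d v (F t)) `^ (p / p) * (t^-1)%:E))%E.
Proof.
pose HE t := hausdorff_content delta (EFin \o w) (E t).
pose HF t := hausdorff_content d v (F t).
have HE0 t : (0 <= HE t)%E by exact: hausdorff_content_ge0.
have HF0 t : (0 <= HF t)%E by exact: hausdorff_content_ge0.
have HEmono : {homo HE : s t / s <= t >-> (t <= s)%E}.
  move=> s t st; apply: le_hausdorff_content => x; apply: le_lt_trans.
  by rewrite lee_fin.
have HFmono : {homo HF : s t / s <= t >-> (t <= s)%E}.
  by move=> s t st; apply: le_hausdorff_content => x; exact: le_lt_trans.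
have upper := le_integral_level p0 q0 HE0 HEmono.
have lower := ge_integral_level p0 HF0 HFmono.
set X := (X in (_ <= C%:E * X)%E).
rewrite -/X in lower.
have X0 : (0 <= X)%E.
  apply: integral_ge0 => t; rewrite /= in_itv/= andbT => t0.
  by rewrite mule_ge0 ?poweR_ge0// lee_fin invr_ge0 ltW.
have [->|Xfin] := eqVneq X +oo%E; first by rewrite gt0_muley ?leey// lte_fin C_gt0.
have sumF : (\esum_(m in [set: int]) (((2 ^ m) `^ p)%:E * HF (2 ^ m)) < +oo)%E.
  apply: le_lt_trans lower _; rewrite lte_mul_pinfty ?lee_fin ?mulr_ge0 ?powR_ge0//.
  by rewrite ltey.
have term0 m : (0 <= ((2 ^ m) `^ p)%:E * HF (2 ^ m))%E.
  by apply: mule_ge0; [rewrite lee_fin powR_ge0|exact: HF0].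
have HFfin m : (HF (2 ^ m)%R < +oo)%E.
  have := @le_esum_seq R _ [set: int] (fun m => ((2 ^ m) `^ p)%:E * HF (2 ^ m))%E [:: m].
  rewrite big_seq1 => /(_ isT (fun _ _ => I))/le_lt_trans/(_ sumF).
  case: (HF _) (HF0 (2 ^ m)) => [r _ _|_|//]; first exact: ltry.
  by rewrite gt0_muley// lte_fin powR_gt0.
apply: le_trans upper _.
rewrite /C EFinM -muleA lee_wpmul2l//.
apply/lee_addgt0Pr => e e0.
(* The coverings contribute an error [C1 e'] and [esum_maximal_level] another [e'], in total [e]. *)
pose e' := e / (C1 + 1).
have e'0 : 0 < e' by rewrite divr_gt0// ltr_wpDl.
have [g g0 ge] := @esum_epsilon R int e' e'0.
(* Dividing the slack by [2^(m p)] leaves exactly [g m] after the level is weighted. *)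
have /choice[JQ hJQ] : forall m, exists JQ : pred nat * (nat -> dyadic n),
   F (2 ^ m) `<=` \bigcup_(j in [set j | JQ.1 j]) cube (JQ.2 j) /\
   (\esum_(j in [set j | JQ.1 j]) (avg (JQ.2 j) v * (side (JQ.2 j) `^ d)%:E) <=
      HF (2 ^ m) + (g m / (2 ^ m) `^ p)%:E)%E.
  move=> m; have gm0 : 0 < g m / (2 ^ m) `^ p by rewrite divr_gt0// powR_gt0.
  have [J [Q [FQ sumQ]]] := hausdorff_content_adherent v_ge0 (HFfin m) gm0.
  by exists (J, Q).
pose J m := (JQ m).1; pose Qf m := (JQ m).2.
pose A := [set i : int * nat | J i.1 i.2].
pose ms (i : int * nat) := mass d p fst (fun i => Qf i.1 i.2)
              (fun i => avg (Qf i.1 i.2) v) i.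
have ms0 i : (0 <= ms i)%E by apply: mass_ge0 => j; exact: avg_ge0.
have SE : (\esum_(i in A) ms i <= (2 * 2 `^ p)%:E * X + e'%:E)%E.
  apply: (@le_trans _ _ (\esum_(m in [set: int])
      (((2 ^ m) `^ p)%:E * HF (2 ^ m) + (g m)%:E))%E).
    have -> : A = [set: int] `*`` (fun m => [set j | J m j]).
      by apply/seteqP; split => -[m j] //= [].
    rewrite (_ : \esum_(i in _) ms i = \esum_(m in [set: int])
        \esum_(j in [set j | J m j]) ms (m, j))%E; last by rewrite esum_esum.
    apply: le_esum => m _; have pm0 : 0 < (2 ^ m : R) `^ p by rewrite powR_gt0.
    apply: (@le_trans _ _ (((2 ^ m) `^ p)%:E *
        (HF (2 ^ m) + (g m / (2 ^ m) `^ p)%:E))%E).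
      apply: le_trans (lee_wpmul2l _ (hJQ m).2); last by rewrite lee_fin ltW.
      rewrite -esumZl ?lee_fin ?(ltW pm0)//.
        by apply: le_esum => j _; rewrite /ms /mass EFinM -muleA [X in (_ * X)%E]muleC.
      by move=> j; rewrite mule_ge0 ?avg_ge0// lee_fin powR_ge0.
    rewrite ge0_muleDr; [|exact: HF0|by rewrite lee_fin divr_ge0// ltW].
    by rewrite -EFinM mulrCA divff ?mulr1// gt_eqF.
  rewrite esumD//; last by move=> m _; rewrite lee_fin ltW.
  exact: leeD.
have Sfin : (\esum_(i in A) ms i < +oo)%E.
  apply: le_lt_trans SE _; rewrite lte_add_pinfty ?ltry//.
  by rewrite lte_mul_pinfty ?lee_fin ?mulr_ge0 ?powR_ge0// ltey.
have := @esum_maximal_level J Qf e' (fun m => (hJQ m).1) Sfin e'0.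
move=> /le_trans; apply.
apply: le_trans (leeD (lee_wpmul2l _ SE) (lexx _)) _; first by rewrite lee_fin.
rewrite ge0_muleDr; last 2 first.
- by rewrite mule_ge0// lee_fin mulr_ge0 ?powR_ge0.
- by rewrite lee_fin ltW.
rewrite muleA -EFinM -addeA leeD2l// -EFinM -EFinD lee_fin.
rewrite -{2}[e'](mul1r) -mulrDl /e' mulrC divfK// gt_eqF// ltr_wpDl//.
Qed.

End strong_type.

Unset Implicit Arguments.

Theorem theorem1p2 (R : realType) (n : nat) (d alpha gamma p q : R) :
  (2 <= n)%N ->
  0 < d <= n%:R ->
  0 <= alpha < n%:R ->
  0 <= gamma <= alpha ->
  d / n%:R < p -> p <= q ->
  (0 < gamma -> q < n%:R / gamma) ->
  (0 < alpha -> p < d / alpha) ->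
  let delta := q / p * (d - (alpha - gamma) * p) in
  exists C : R, 0 < C /\
    forall w f : 'rV[R]_n -> R, weight w -> locally_integrable_rV f ->
      (choquet_lorentz q p delta (EFin \o w) (dyadic_maximal alpha f)
       <= C%:E *
          choquet p d (fun x => dyadic_maximal (gamma * q) w x `^ (p / q))
            (EFin \o f))%E.
Proof.
move=> n2 /andP[d0 dn] /andP[alpha0 alphan] _ dp pq _ _ delta.
have n0 : (0 < n)%N by exact: ltn_trans n2.
have nR0 : 0 < n%:R :> R by rewrite ltr0n.
have p0 : 0 < p by apply: lt_trans dp; exact: divr_gt0.
pose C := 2 `^ p * ((8 `^ (d / n%:R) * geometric_const 8 (p - d / n%:R) +
   geometric_const 8 p) * (2 * 2 `^ p)).
have C0 : 0 < C by exact: C_gt0.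
(* Both quasinorms carry the outer exponent [1/p], so the constant of the integral inequality
   receives it too. *)
exists (C `^ p^-1); split; first exact: powR_gt0.
move=> w f [w0 _] _.
have := @maximal_integral_le R n d alpha gamma p q n0 d0 dn alpha0 alphan dp pq w f w0.
rewrite -/C -/delta => main.
have int0 (F : R -> \bar R) (r : R) :
    (0 <= \int[lebesgue_measure]_(t in `]0%R, +oo[) (F t `^ r * (t^-1)%:E))%E.
  apply: integral_ge0 => t; rewrite /= in_itv/= andbT => t0.
  by rewrite mule_ge0 ?poweR_ge0// lee_fin invr_ge0 ltW.
rewrite /choquet /choquet_lorentz -poweR_EFin -poweRM ?lee_fin ?(ltW C0)//.
apply: le_poweR; [by rewrite invr_ge0 ltW|exact: int0|].
apply: le_trans main; rewrite le_eqVlt; apply/orP; left; apply/eqP.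
apply: eq_integral => t _; congr ((_ * hausdorff_content _ _ _) `^ _ * _)%E.
by apply/seteqP; split => x /=; rewrite gee0_abs// dyadic_maximal_ge0.
Qed.
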